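(* Let $n=n(m)$ be even, $\lambda=\lambda(n)>0$, $r=r(n)\ge 0$, and let $A$ be drawn from the $(m,n,\lambda)$-Poisson ensemble. If $m=o(n)$ and $\log\mathbb{E}[Z_r]=\Theta(n)$, then $\mathrm{disc}(A)\le r+1$ with high probability, i.e. with probability tending to $1$ as $m\to\infty$.
   Context: For $A\in\mathbb{R}^{m\times n}$, $\mathrm{disc}(A)=\min_{u\in\{-1,+1\}^n}\|Au\|_\infty$. The $(m,n,\lambda)$-Poisson ensemble is the law of an $m\times n$ random matrix with i.i.d. Poisson$(\lambda)$ entries. A vector $u\in\{-1,+1\}^n$ is balanced if $\sum_{i=1}^n u_i=0$; $\mathcal{B}$ is the set of balanced vectors. For $r\ge0$, $Z_r$ is the number of $u\in\mathcal{B}$ with $\|Au\|_\infty\le r$. Asymptotics are as $m\to\infty$ (hence $n\to\infty$); $\log\mathbb{E}[Z_r]=\Theta(n)$ means there are constants $0<c\le c'$ with $cn\le\log\mathbb{E}[Z_r]\le c'n$ for all sufficiently large $m$. *)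

(* Defs.v *)
From HB Require Import structures.
From mathcomp Require Import all_boot all_order all_algebra.
From mathcomp Require Import all_classical all_reals all_analysis.

Set Implicit Arguments.
Unset Strict Implicit.
Unset Printing Implicit Defensive.

Import Order.TTheory GRing.Theory Num.Theory.
Import numFieldNormedType.Exports.

Local Open Scope classical_set_scope.
Local Open Scope ring_scope.

(* The cube {-1,+1}^n is encoded by {ffun 'I_n -> bool}, s standing for the
   vector u with u_i = (-1)^(s i). *)
Definition sign_vec (R : realType) (n : nat) (s : {ffun 'I_n -> bool}) :
    'cV[R]_n :=
  \col_i (-1) ^+ s i.

Definition balanced (R : realType) (n : nat) (s : {ffun 'I_n -> bool}) : bool :=
  \sum_i sign_vec R s i 0 == 0.

(* The norm of a matrix is the maximum of the absolute values of its entries,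
   so that `|_| is the l^oo norm on column vectors. The default value of the
   minimum is the value at u = (1, ..., 1), hence the minimum is genuine. *)
Definition disc (R : realType) (m n : nat) (A : 'M[R]_(m, n)) : R :=
  \big[Num.min/`|A *m sign_vec R [ffun=> false]|]_(s : {ffun 'I_n -> bool})
    `|A *m sign_vec R s|.

Definition balanced_count (R : realType) (m n : nat) (r : R)
    (A : 'M[R]_(m, n)) : nat :=
  #|[pred s : {ffun 'I_n -> bool} |
      balanced R s && (`|A *m sign_vec R s| <= r)]|.

Definition mutually_independent (d d' : measure_display)
    (T : measurableType d) (T' : measurableType d') (R : realType)
    (P : probability T R) (I : finType) (X : I -> T -> T') : Prop :=
  forall (J : {set I}) (B : I -> set T'), (forall i, measurable (B i)) ->
    P (\bigcap_(i in [set` J]) X i @^-1` B i) =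
    (\prod_(i in J) P (X i @^-1` B i))%E.

(* Every subset of nat is measurable, so measurability of an entry means that
   all its level sets are events. *)
Definition poisson_ensemble (d : measure_display) (T : measurableType d)
    (R : realType) (P : probability T R) (m n : nat) (lambda : R)
    (A : T -> 'M[nat]_(m, n)) : Prop :=
  [/\ forall i j, measurable_fun [set: T] (fun w => A w i j),
      forall i j (k : nat),
        P [set w | A w i j = k] = (poisson_pmf lambda k)%:E &
      mutually_independent P
        (fun (ij : 'I_m * 'I_n) (w : T) => A w ij.1 ij.2)].

Definition natmx (R : realType) (m n : nat) (A : 'M[nat]_(m, n)) :
    'M[R]_(m, n) :=
  map_mx (fun k : nat => k%:R) A.

(* Main.v *)
Require Import Defs.
From mathcomp Require Import all_boot all_order all_algebra.
From mathcomp Require Import all_classical all_reals all_analysis.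
From mathcomp Require Import ring lra zify.

Set Implicit Arguments.
Unset Strict Implicit.
Unset Printing Implicit Defensive.

Import Order.TTheory GRing.Theory Num.Theory.
Import numFieldNormedType.Exports.

Local Open Scope classical_set_scope.
Local Open Scope ring_scope.

(* Second moment method, conditionally on the row sums. Given that a row has sum N, it is the
   occupation vector of N independent uniform columns, so its product with a balanced u is a
   simple random walk of length N, and its products with balanced u and v are two walks whose
   steps have correlation rho = <u, v> / n. Enlarging the window to k = floor r + 1 makes every
   row admissible whatever the parity of its sum. Write q for the probability that the walk ends
   in [-k, k] and Q(rho) for the joint probability. Expanding in the Walsh basis, Q is an even
   power series in rho with nonnegative coefficients; together with Q(rho0) <= K q^2 for a fixed
   rho0 < 1 this gives Q(rho) <= q^2 (1 + K' rho^2) for |rho| <= rho0. As m = o(n), these pairs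
   contribute a factor 1 + o(1) to the second moment. The exponentially rare pairs with
   |rho| > rho0 are handled by Q <= q, since the conditional first moment is exponentially large:
   it is at least exp(-O(m)) E[Z_r] unless the total of the row sums is atypically large.
   All probabilities are finite sums over matrices with entries below a truncation level K, the
   limit in K being taken only at the end. *)

(** Conditioning on the row sums is forced by their fluctuation: [q] depends on the row sum, and the
    mean of [q ^ 2] can exceed the squared mean of [q] by a constant factor in every row, hence by a
    factor exponential in [m], which would ruin an unconditional second moment. Parity is the
    extreme case: with window 0, an odd row sum excludes every [u]. Evenness in [rho] matters
    because typical overlaps have order [1 / sqrt n]: an exponent [m * rho ^ 2] is then of order
    [m / n], while a linear term [m * rho] would be harmless only for [m = o(sqrt n)]. All constants
    must be uniform in the row sum [N] and the window [k]. Up to constant factors [q] is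
    [min(1, k / sqrt(N + 1))]: the upper bound comes from the largest binomial coefficient, the
    lower one from Chebyshev and unimodality, and their comparison at correlation [rho0] gives
    [Q(rho0) <= K q^2]. As [1 / q] grows no faster than the square root of [N], the product of the
    [1 / q] is bounded by an exponential in the total of the row sums; this is why only that total
    has to be controlled. *)

(** * Bounds on binomial coefficients *)

Lemma leq_bin_half (N i j : nat) : (i <= j)%N -> (j.*2 <= N)%N -> ('C(N, i) <= 'C(N, j))%N.
Proof.
elim: j => [|j IHj]; first by rewrite leqn0 => /eqP ->.
rewrite leq_eqVlt => /predU1P[-> //|]; rewrite ltnS => ij jN.
apply: (leq_trans (IHj ij _)); first lia.
have E := mul_bin_left N j; have jN2 : (j.+1 <= N - j)%N by lia.
rewrite -(leq_pmul2l (ltn0Sn j)) E leq_mul2r; apply/orP; right; exact: jN2.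
Qed.

Lemma leq_bin_unimodal (N i j : nat) : (i <= N)%N -> (j <= N)%N ->
  (maxn j (N - j) <= maxn i (N - i))%N -> ('C(N, i) <= 'C(N, j))%N.
Proof.
move=> iN jN ij.
have binmin (k : nat) : (k <= N)%N -> 'C(N, k) = 'C(N, minn k (N - k)).
  move=> kN; rewrite /minn; case: ltnP => // _; by rewrite bin_sub.
rewrite (binmin i) // (binmin j) //; apply: leq_bin_half; lia.
Qed.

Lemma mul_central_binS (h : nat) : (h.+1 * 'C(h.+1.*2, h.+1) = 2 * h.*2.+1 * 'C(h.*2, h))%N.
Proof.
have E1 := mul_bin_diag h.*2.+1 h.
have E2 := mul_bin_left h.*2.+1 h.
have E3 := mul_bin_diag h.*2 h.
have E4 := binS h.*2.+1 h.
rewrite /= -/(h.+1.*2) in E1.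
have -> : h.+1.*2 = h.*2.+2 by lia.
have e : (h.*2.+1 - h = h.+1)%N by lia.
have E5 := mul_bin_down h.*2 h.
rewrite /= e in E2 E5.
have eC : 'C(h.*2.+1, h.+1) = 'C(h.*2.+1, h).
  by apply/eqP; rewrite -(eqn_pmul2l (ltn0Sn h)) E2.
rewrite E4 eC; nia.
Qed.

(** Squared, to stay in the integers. The induction step reduces to
    [(2h + 1)(2h + 3) <= (2h + 2) ^ 2]; that of the matching lower bound below reduces to
    [4 (h + 1)(h + 2) <= (2h + 3) ^ 2]. *)
Lemma central_bin_upper (h : nat) : ('C(h.*2, h) ^ 2 * h.*2.+1 <= 16 ^ h)%N.
Proof.
elim: h => // h IH; rewrite -(leq_pmul2l (_ : 0 < h.+1 ^ 2)%N) //.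
have E := mul_central_binS h.
rewrite mulnA -expnMn E [(16 ^ _.+1)%N]expnS.
have -> : h.+1.*2.+1 = (h.*2 + 3)%N by lia.
set C := 'C(_, _) in IH *; set X := (16 ^ h)%N in IH *.
have : ((2 * h.*2.+1 * C) ^ 2 * (h.*2 + 3) = C ^ 2 * h.*2.+1 * (4 * h.*2.+1 * (h.*2 + 3)))%N by ring.
move=> ->; apply: (leq_trans (leq_mul IH (leqnn _))).
rewrite [leqRHS]mulnA [leqRHS]mulnC leq_mul2l -muln2; apply/orP; right; nia.
Qed.

Lemma central_bin_lower (h : nat) : (0 < h)%N -> (16 ^ h <= 4 * h * 'C(h.*2, h) ^ 2)%N.
Proof.
case: h => // h _; elim: h => // h IH.
rewrite -(leq_pmul2l (_ : 0 < h.+2 ^ 2)%N) //.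
have E := mul_central_binS h.+1.
set C := 'C(_, _) in IH E; set C' := 'C(_, _) in E *.
have -> : (h.+2 ^ 2 * (4 * h.+2 * C' ^ 2) = 4 * h.+2 * (h.+2 * C') ^ 2)%N by ring.
rewrite E [(16 ^ _.+1)%N]expnS.
have -> : (4 * h.+2 * (2 * h.+1.*2.+1 * C) ^ 2 = (4 * h.+1.*2.+1 ^ 2 * h.+2) * (4 * C ^ 2))%N by ring.
set X := (16 ^ h.+1)%N in IH *.
have H : (16 * h.+1 * h.+2 <= 4 * h.+1.*2.+1 ^ 2)%N.
  have -> : (4 * h.+1.*2.+1 ^ 2 = 16 * h.+1 * h.+2 + 4)%N by rewrite -muln2; ring.
  exact: leq_addr.
apply: (@leq_trans ((16 * h.+1 * h.+2 * h.+2) * (4 * C ^ 2))); last first.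
  by rewrite leq_mul2r leq_mul2r H !orbT.
have -> : (16 * h.+1 * h.+2 * h.+2 * (4 * C ^ 2) = 16 * h.+2 ^ 2 * (4 * h.+1 * C ^ 2))%N by ring.
by rewrite mulnA [(_ * 16)%N]mulnC leq_mul2l IH orbT.
Qed.

(** An odd row has no central coefficient to compare with. Pascal's rule and unimodality give
    [2 C(N, j) <= C(N + 1, j + 1)] for [j] in the lower half, which reduces it to the even row
    [N + 1]. *)
Lemma sqr_bin_upper (N j : nat) : ('C(N, j) ^ 2 * N.+1 <= 4 ^ N)%N.
Proof.
have [jN|jN] := leqP j N; last by rewrite bin_small.
have key (h i : nat) : ('C(h.*2, i) ^ 2 * h.*2.+1 <= 16 ^ h)%N.
  apply: leq_trans (central_bin_upper h); rewrite leq_mul2r leq_sqr.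
  have [ih|ih] := leqP i h.*2; last by rewrite bin_small.
  by rewrite leq_bin_unimodal; lia.
have p4 (h : nat) : (4 ^ h.*2 = 16 ^ h)%N by rewrite -muln2 mulnC expnM.
rewrite -[N]odd_double_half in jN *; case: (odd N) in jN *; last by rewrite add0n p4.
rewrite add1n in jN *; move: N./2 jN => h jN.
wlog jh : j jN / (j <= h)%N => [wl|].
  have [/wl->//|jh] := leqP j h.
  by rewrite -bin_sub //; apply: wl; lia.
have k := key h.+1 j.+1.
have E : ('C(h.*2.+1, j) + 'C(h.*2.+1, j.+1) = 'C(h.+1.*2, j.+1))%N.
  by rewrite addnC -binS doubleS.
have L : ('C(h.*2.+1, j) <= 'C(h.*2.+1, j.+1))%N.
  by apply: leq_bin_unimodal; lia.
have L2 : (2 * 'C(h.*2.+1, j) <= 'C(h.+1.*2, j.+1))%N by lia.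
have := leq_mul (_ : (2 * 'C(h.*2.+1, j)) ^ 2 <= 'C(h.+1.*2, j.+1) ^ 2)%N
  (_ : h.*2.+2 <= h.+1.*2.+1)%N.
rewrite leq_sqr => /(_ L2 ltac:(lia)) k2.
have {k2 k} := leq_trans k2 k; rewrite expnMn => k.
by rewrite -(leq_pmul2l (_ : 0 < 4)%N) // -expnS mulnA -doubleS p4.
Qed.

(** Overlaps of balanced vectors have weights [C(h, a) ^ 2 / C(2h, h)]. Bounding one of the two
    factors this way leaves twice the binomial law, for which walk estimates are available. *)
Lemma bin_le_central (h a : nat) : ('C(h, a) * 2 ^ h <= 2 * 'C(h.*2, h))%N.
Proof.
case: h => [|h]; first by case: a.
have U := sqr_bin_upper h.+1 a.
have L := central_bin_lower (ltn0Sn h).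
have p16 : (16 ^ h.+1 = 4 ^ h.+1 * 4 ^ h.+1)%N by rewrite -expnMn.
have p4 : (4 ^ h.+1 = (2 ^ h.+1) ^ 2)%N by rewrite -expnM mulnC expnM.
rewrite -leq_sqr !expnMn -p4 -(leq_pmul2r (ltn0Sn h)).
set X := (4 ^ h.+1)%N in U p16 *.
have := leq_mul U (leqnn X); rewrite -p16; nia.
Qed.

(** * Sign sequences, their walks and the window *)

Lemma sum_card_set (V : nmodType) (I : finType) (F : nat -> V) :
  \sum_(J : {set I}) F #|J| = \sum_(k < #|I|.+1) F k *+ 'C(#|I|, k).
Proof.
rewrite (partition_big (fun J : {set I} => inord #|J| : 'I_#|I|.+1) xpredT) //=.
apply: eq_bigr => k _; have D := card_draws I k.
have kE (J : {set I}) : (inord #|J| == k) = (J \in [set A : {set I} | #|A| == k]%SET).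
  by rewrite inE -val_eqE /= inordK // ltnS max_card.
rewrite (eq_bigl _ _ kE) -D -sumr_const; apply: eq_bigr => J.
by rewrite inE => /eqP ->.
Qed.

Lemma sum_ffun_bool (V : nmodType) (I : finType) (F : {ffun I -> bool} -> V) :
  \sum_e F e = \sum_(J : {set I}) F [ffun i => i \in J].
Proof.
rewrite (reindex (fun J : {set I} => [ffun i => i \in J])) //=.
exists (fun e : {ffun I -> bool} => [set i | e i]%SET) => [J _|e _].
  by apply/setP => i; rewrite inE ffunE.
by apply/ffunP => i; rewrite ffunE inE.
Qed.

Definition walk (I : finType) (e : {ffun I -> bool}) : int := \sum_i (-1) ^+ e i.

Definition window (kap : nat) (I : finType) (e : {ffun I -> bool}) : bool :=
  `|walk e| <= kap%:Z.

(** The condition [|N - 2k| <= kap] without subtraction: [k] is the number of minus signs of a walk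
    of length [N]. *)
Definition in_window (kap N k : nat) : bool :=
  ((N <= k.*2 + kap) && (k.*2 <= N + kap))%N.

Lemma walk_set (I : finType) (J : {set I}) :
  walk [ffun i => i \in J] = #|I|%:Z - (#|J|.*2)%:Z.
Proof.
rewrite /walk (eq_bigr (fun i => 1 - (2 * (i \in J)%:Z))); last first.
  by move=> i _; rewrite ffunE; case: (i \in J).
rewrite sumrB sumr_const -mulr_sumr.
have -> : \sum_(i : I) (i \in J)%:Z = #|J|%:Z.
  rewrite -[RHS]natz -sum1_card natr_sum [RHS]big_mkcond /=.
  by apply: eq_bigr => i _; case: (i \in J).
by rewrite -mul2n PoszM !natz.
Qed.

Lemma window_set (kap : nat) (I : finType) (J : {set I}) :
  window kap [ffun i => i \in J] = in_window kap #|I| #|J|.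
Proof. by rewrite /window walk_set /in_window; lia. Qed.

(** The endpoint of the walk has the parity of [N], so only every other integer of [[-kap, kap]] is
    available. *)
Lemma card_in_window (kap N : nat) : (#|[set a : 'I_N.+1 | in_window kap N a]%SET| <= kap.+1)%N.
Proof.
pose f (a : 'I_N.+1) : 'I_kap.+1 := inord ((a.*2 + kap - N)./2).
have fE (a : 'I_N.+1) : in_window kap N a -> f a = (a.*2 + kap - N)./2 :> nat.
  move=> /andP[h1 h2]; rewrite inordK //; lia.
rewrite -[leqRHS]card_ord -(@card_in_imset _ _ f) ?max_card // => a b.
rewrite !inE => aW bW /(congr1 val) /=; rewrite !fE // => ab; apply: val_inj => /=.
move: aW bW ab => /andP[a1 _] /andP[b1 _]; move: (nat_of_ord a) (nat_of_ord b) a1 b1.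
by clear; move=> a b a1 b1 ab; lia.
Qed.

Lemma card_agree_off (I : finType) (J E : {set I}) (a : nat) :
  (#|[set D : {set I} | (#|D| == a) && (D :\: J == E :\: J)]%SET| <= 'C(#|J|, a - #|E :\: J|))%N.
Proof.
rewrite -cards_draws -[leqLHS](@card_in_imset _ _ (fun D => D :&: J)); last first.
  move=> D D'; rewrite !inE => /andP[_ /eqP DE] /andP[_ /eqP D'E] DD'.
  by rewrite -(setID D J) -(setID D' J) DE D'E DD'.
apply: subset_leq_card; apply/fintype.subsetP => _ /imsetP[D + ->]; rewrite !inE => /andP[/eqP <- /eqP <-].
by rewrite subsetIr -(cardsID J D) addnK eqxx.
Qed.

Section Window.
Variable R : realType.

Lemma bin_le_sqrt (k j : nat) : 'C(k, j)%:R <= 2 ^+ k / Num.sqrt k.+1%:R :> R.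
Proof.
have s0 : 0 < Num.sqrt k.+1%:R :> R by rewrite sqrtr_gt0.
rewrite ler_pdivlMr // -ler_sqr ?nnegrE ?mulr_ge0 ?exprn_ge0 // exprMn sqr_sqrtr //.
rewrite -exprM mulnC exprM -natrX -natrX -natrM.
by have := sqr_bin_upper k j; rewrite -(ler_nat R) => /le_trans; apply; rewrite natrX -natrX.
Qed.

(** Anticoncentration with the signs outside [J] frozen: each of the at most [kap + 1] endpoints
    prescribes how many signs inside [J] are negative, and thus costs one binomial coefficient of
    row [#|J|]. *)
Lemma card_window_agree (kap : nat) (I : finType) (J E : {set I}) :
  \sum_(D : {set I} | D :\: J == E :\: J) (in_window kap #|I| #|D|)%:R
    <= kap.+1%:R * (2 ^+ #|J| / Num.sqrt #|J|.+1%:R) :> R.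
Proof.
rewrite (partition_big (fun D : {set I} => inord #|D| : 'I_#|I|.+1) xpredT) //=.
apply: (@le_trans _ _ (\sum_(a : 'I_#|I|.+1 | in_window kap #|I| a)
  (2 ^+ #|J| / Num.sqrt #|J|.+1%:R))); last first.
  rewrite sumr_const -[leLHS]mulr_natl ler_wpM2r ?divr_ge0 ?exprn_ge0 ?sqrtr_ge0 //.
  rewrite ler_nat; apply: leq_trans (card_in_window kap #|I|).
  by rewrite cardsE.
rewrite [leRHS]big_mkcond; apply: ler_sum => a _.
have aE (D : {set I}) : (inord #|D| == a) = (#|D| == a).
  by rewrite -val_eqE /= inordK // ltnS max_card.
under eq_bigl => D do rewrite aE.
rewrite (eq_bigr (fun=> (in_window kap #|I| a)%:R)); last by move=> D /andP[_ /eqP->].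
case: ifP => _; last by rewrite big1.
rewrite -natr_sum sum1_card; apply: le_trans (bin_le_sqrt _ (a - #|E :\: J|)).
rewrite ler_nat; apply: leq_trans (card_agree_off J E a).
by apply: subset_leq_card; apply/fintype.subsetP => D; rewrite !inE andbC.
Qed.

End Window.

(** * Anticoncentration of a walk correlated with a given one *)

Section BiasedWindow.
Variable R : realType.

(** The geometric mean of [s / x] and [1 / s] is [1 / sqrt x]. If [1 / x] has mean at most
    [1 / s ^ 2], averaging gives the bound [1 / s] for the mean of [1 / sqrt x]. *)
Lemma inv_sqrt_le (s x : R) : 0 < s -> 0 < x -> (Num.sqrt x)^-1 <= (s / x + s^-1) / 2.
Proof.
move=> s0 x0; rewrite -[in s / x](sqr_sqrtr (ltW x0)).
have : 0 < Num.sqrt x by rewrite sqrtr_gt0.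
move: (Num.sqrt x) => t t0; rewrite -subr_ge0.
have -> : (s / t ^+ 2 + s^-1) / 2 - t^-1 = (s / t - 1) ^+ 2 / (2 * s).
  by field; rewrite !gt_eqF.
by rewrite divr_ge0 ?sqr_ge0 // mulr_ge0 // ltW.
Qed.

(** Dividing [C(N, k)] by [k + 1] gives [C(N + 1, k + 1) / (N + 1)], so the sum becomes the binomial
    expansion of [1] with exponent [N + 1], less its first term. *)
Lemma sum_binomial_inv (rho : R) (N : nat) : 0 <= rho -> rho < 1 ->
  \sum_(k < N.+1) ((1 - rho) ^+ k * rho ^+ (N - k) / k.+1%:R) *+ 'C(N, k)
    <= ((1 - rho) * N.+1%:R)^-1.
Proof.
move=> r0 r1; have a0 : 0 < 1 - rho by rewrite subr_gt0.
have c0 : 0 < (1 - rho) * N.+1%:R by rewrite mulr_gt0.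
rewrite -[leRHS]mul1r ler_pdivlMr // mulr_suml.
apply: (@le_trans _ _ ((rho + (1 - rho)) ^+ N.+1)); last by rewrite addrC subrK expr1n.
rewrite [leRHS]exprDn [leRHS]big_ord_recl. apply: ler_wpDl.
  by rewrite mulrn_wge0 // mulr_ge0 ?exprn_ge0 // ltW.
apply: ler_sum => k _; rewrite !lift0 subSS exprS.
have /= := mul_bin_diag N.+1 k => /(congr1 (fun n => n%:R : R)); rewrite !natrM => E.
rewrite -[(_ / _) *+ _]mulr_natr -[in leRHS]mulr_natr le_eqVlt; apply/orP; left; apply/eqP.
have k0 : k.+1%:R != 0 :> R by rewrite pnatr_eq0.
rewrite [_ * _%:R in LHS]mulrC.
have -> : 'C(N.+1, k.+1)%:R = N.+1%:R * 'C(N, k)%:R / k.+1%:R :> R by rewrite E; field.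
by move: (k.+1%:R) k0 => x x0; field.
Qed.

Lemma sum_binomial_inv_sqrt (rho : R) (I : finType) : 0 <= rho -> rho < 1 ->
  \sum_(J : {set I}) (1 - rho) ^+ #|J| * rho ^+ (#|I| - #|J|) / Num.sqrt #|J|.+1%:R
    <= (Num.sqrt ((1 - rho) * #|I|.+1%:R))^-1.
Proof.
move=> r0 r1; have a0 : 0 < 1 - rho by rewrite subr_gt0.
have c0 : 0 < (1 - rho) * #|I|.+1%:R by rewrite mulr_gt0.
rewrite (sum_card_set _ (fun k => (1 - rho) ^+ k * rho ^+ (#|I| - k) / Num.sqrt k.+1%:R)).
set s := Num.sqrt _; have s0 : 0 < s by rewrite sqrtr_gt0.
set N := #|I|; pose w k := (1 - rho) ^+ k * rho ^+ (N - k).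
have w0 k : 0 <= w k by rewrite mulr_ge0 ?exprn_ge0 // ltW.
have amgm (x : R) : 0 < x -> (Num.sqrt x)^-1 <= (s / x + s^-1) / 2 by exact: inv_sqrt_le.
have gen (a b c d : R) (n : nat) :
    (a * ((b * c) *+ n) + d * (b *+ n)) / 2 = (b * ((a * c + d) / 2)) *+ n.
  by rewrite -(mulr_natr (b * c)) -(mulr_natr b n) -(mulr_natr (b * _)); ring.
apply: (@le_trans _ _ ((s * (\sum_(k < N.+1) (w k / k.+1%:R) *+ 'C(N, k))
   + s^-1 * (\sum_(k < N.+1) w k *+ 'C(N, k))) / 2)).
  rewrite !mulr_sumr -big_split mulr_suml /=; apply: ler_sum => k _.
  rewrite gen lerMn2r; apply/orP; right.
  exact: (ler_wpM2l (w0 k) (amgm k.+1%:R (ltr0Sn _ _))).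
have -> : \sum_(k < N.+1) w k *+ 'C(N, k) = 1.
  transitivity ((rho + (1 - rho)) ^+ N); last by rewrite addrC subrK expr1n.
  by rewrite exprDn; apply: eq_bigr => k _; rewrite mulrC.
rewrite mulr1 ler_pdivrMr // [_ * 2]mulrDr mulr1 lerD2r.
have -> : s^-1 = s * ((1 - rho) * N.+1%:R)^-1.
  by rewrite -[_ * N.+1%:R]sqr_sqrtr ?ltW // -/s expr2 invfM mulrA mulfV ?mul1r // gt_eqF.
apply: (ler_wpM2l (ltW s0)); exact: sum_binomial_inv.
Qed.

Lemma prod_if_indicator (I : finType) (J : {set I}) (P : pred I) (x y : R) :
  \prod_i (if i \in J then x else y * (P i)%:R) =
  x ^+ #|J| * y ^+ (#|I| - #|J|) * [forall (i | i \notin J), P i]%:R.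
Proof.
rewrite (bigID (mem J)) /= (eq_bigr (fun=> x)); last by move=> i ->.
rewrite prodr_const [X in _ * X](eq_bigr (fun i => y * (P i)%:R)); last first.
  by move=> i /negbTE ->.
rewrite big_split /= prodr_const mulrA; congr (_ * _ ^+ _ * _).
  by rewrite -[in RHS](finset.setCK J) -cardsCs -cardsE; apply: eq_card => i; rewrite !inE.
case: forallP => [H|/forallP].
  by rewrite big1 // => i /negbTE iJ; have := H i; rewrite iJ /= => ->.
rewrite negb_forall => /existsP[i]; rewrite negb_imply => /andP[iJ /negbTE Pi].
by rewrite (bigD1 i) //= Pi mul0r.
Qed.

(* [1 + rho e e' = (1 - rho) + 2 rho [e = e']]: each sign of [e'] is resampled with
   probability [1 - rho], and the resampled signs anticoncentrate. *)
Lemma biased_window (kap : nat) (I : finType) (rho : R) (e : {ffun I -> bool}) :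
  0 <= rho -> rho < 1 ->
  \sum_e' (window kap e')%:R * \prod_i (1 + rho * ((-1) ^+ e i * (-1) ^+ e' i))
    <= 2 ^+ #|I| * kap.+1%:R / Num.sqrt ((1 - rho) * #|I|.+1%:R).
Proof.
move=> r0 r1; have a0 : 0 < 1 - rho by rewrite subr_gt0.
rewrite sum_ffun_bool; pose E := [set i | e i]%SET; have eE i : (i \in E) = e i by rewrite /E inE.
have prodE (D : {set I}) :
    \prod_i (1 + rho * ((-1) ^+ e i * (-1) ^+ [ffun i => i \in D] i)) =
    \sum_(J : {set I}) (1 - rho) ^+ #|J| * (2 * rho) ^+ (#|I| - #|J|)
       * (D :\: J == E :\: J)%:R.
  rewrite (eq_bigr (fun i => (1 - rho) + 2 * rho * ((i \in D) == (i \in E))%:R)); last first.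
    by move=> i _; rewrite ffunE eE; case: (e i); case: (i \in D); rewrite /= ?expr1 ?expr0; ring.
  rewrite bigA_distr; apply: eq_bigr => J _.
  rewrite (prod_if_indicator J (fun i => (i \in D) == (i \in E))); congr (_ * _%:R).
  congr nat_of_bool; apply/forallP/eqP => [H|H i].
    apply/setP => i; have := H i; rewrite !finset.in_setD.
    by case: (i \in J) => //= /eqP ->.
  by apply/implyP => iJ; have /setP/(_ i) := H; rewrite !finset.in_setD iJ /= => ->.
under eq_bigr => D _ do rewrite window_set prodE mulr_sumr.
rewrite exchange_big /=.
apply: (@le_trans _ _ (\sum_(J : {set I}) (2 ^+ #|I| * kap.+1%:R) *
  ((1 - rho) ^+ #|J| * rho ^+ (#|I| - #|J|) / Num.sqrt #|J|.+1%:R))); last first.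
  by rewrite -mulr_sumr ler_wpM2l ?mulr_ge0 ?exprn_ge0 //; exact: sum_binomial_inv_sqrt.
apply: ler_sum => J _.
have -> : 2 ^+ #|I| * kap.+1%:R * ((1 - rho) ^+ #|J| * rho ^+ (#|I| - #|J|) / Num.sqrt #|J|.+1%:R)
  = (1 - rho) ^+ #|J| * (2 * rho) ^+ (#|I| - #|J|) *
    (kap.+1%:R * (2 ^+ #|J| / Num.sqrt #|J|.+1%:R)).
  have -> : 2 ^+ #|I| = 2 ^+ #|J| * 2 ^+ (#|I| - #|J|) :> R.
    by rewrite -exprD subnKC // max_card.
  by rewrite exprMn; ring.
apply: le_trans (ler_wpM2l _ (@card_window_agree R kap _ J E)); last first.
  by rewrite mulr_ge0 ?exprn_ge0 ?mulr_ge0 // ltW.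
rewrite [in leRHS]big_mkcond mulr_sumr; apply: ler_sum => D _.
by case: eqP => _; rewrite ?mulr0 ?mulr1 // mulrC.
Qed.

End BiasedWindow.

(** * Second and exponential moments of the simple random walk *)

Lemma sum_binS (V : nmodType) (N : nat) (G : nat -> V) :
  \sum_(k < N.+2) G k *+ 'C(N.+1, k) =
  \sum_(k < N.+1) G k *+ 'C(N, k) + \sum_(k < N.+1) G k.+1 *+ 'C(N, k).
Proof.
rewrite big_ord_recl /= (eq_bigr (fun k : 'I_N.+1 =>
  G k.+1 *+ 'C(N, k.+1) + G k.+1 *+ 'C(N, k))); last first.
  by move=> k _; rewrite binS mulrnDr.
rewrite big_split addrA /=; congr (_ + _).
transitivity (\sum_(k < N.+2) G k *+ 'C(N, k)); first by rewrite [RHS]big_ord_recl !bin0.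
by rewrite big_ord_recr /= bin_small // mulr0n addr0.
Qed.

Lemma sum_bin (N : nat) : (\sum_(k < N.+1) 'C(N, k) = 2 ^ N)%N.
Proof.
by rewrite (Pascal 1 1 N); apply: eq_bigr => k _; rewrite !exp1n !muln1.
Qed.

Lemma sum_bin_sqr (R : comPzRingType) (N : nat) :
  \sum_(k < N.+1) (N%:R - k.*2%:R : R) ^+ 2 *+ 'C(N, k) = N%:R * 2 ^+ N.
Proof.
elim: N => [|N IH]; first by rewrite big_ord1 mul0r subrr expr0n.
rewrite (sum_binS N (fun k => (N.+1%:R - k.*2%:R : R) ^+ 2)) -big_split /=.
rewrite (eq_bigr (fun k : 'I_N.+1 => ((N%:R - k.*2%:R : R) ^+ 2 *+ 'C(N, k)) * 2
   + 2 * 'C(N, k)%:R)); last first.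
  move=> k _; rewrite -[_ *+ 'C(N, k) in RHS]mulr_natr -[X in X + _ = _]mulr_natr.
  rewrite -[X in _ + X = _]mulr_natr -!muln2 !natrM -!natr1; ring.
rewrite big_split /= -mulr_suml IH -mulr_sumr -natr_sum sum_bin natrX -natr1 exprS; ring.
Qed.

Section WalkMoments.
Variable R : realType.

(** The optimal constant is [1/2]; with [2] an elementary proof suffices, since [x <= 2 x ^ 2] once
    [x >= 1/2]. Applied to [2 s / c], this constant produces the [8] of [walk_mean_expR]. *)
Lemma cosh_le (x : R) : expR x + expR (- x) <= 2 * expR (2 * x ^+ 2).
Proof.
wlog x0 : x / 0 <= x => [wl|].
  have [/wl//|/ltW x0] := leP 0 x.
  by have := wl (- x); rewrite oppr_ge0 x0 opprK sqrrN addrC; apply.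
have [xh|xh] := leP 2^-1 x.
  rewrite mulr2n mulrDl !mul1r; apply: lerD; rewrite ler_expR.
    rewrite expr2 mulrA ler_peMl //; lra.
  apply: (@le_trans _ _ 0); first by rewrite oppr_le0.
  by rewrite mulr_ge0 // sqr_ge0.
have e1 : expR x <= (1 - x)^-1.
  rewrite -[expR x]invrK lef_pV2 ?posrE ?invr_gt0 ?expR_gt0 //; last lra.
  by rewrite -expRN; exact: expR_ge1Dx.
have e2 : expR (- x) <= (1 + x)^-1.
  by rewrite expRN lef_pV2 ?posrE ?expR_gt0 ?expR_ge1Dx //; lra.
apply: (le_trans (lerD e1 e2)).
apply: (@le_trans _ _ (2 * (1 + 2 * x ^+ 2))); last first.
  by rewrite ler_wpM2l // expR_ge1Dx.
have y0 : 0 <= x ^+ 2 by rewrite sqr_ge0.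
have y1 : x ^+ 2 <= 2^-1.
  apply: (@le_trans _ _ (x * 1)); last lra.
  by rewrite expr2 ler_wpM2l //; lra.
have -> : (1 - x)^-1 + (1 + x)^-1 = 2 / (1 - x ^+ 2).
  by field; rewrite !gt_eqF //=; lra.
rewrite ler_pdivrMr; last by lra.
by rewrite -mulrA ler_peMr //; nra.
Qed.

(* Moving one step turns [exp (s^2 / c)] into at most [exp (1 / c) * exp (s^2 / (c - 8))]
   on average. *)
Lemma walk_mean_expR (N : nat) (c : R) : 8 * N%:R < c ->
  \sum_(k < N.+1) expR ((N%:R - k.*2%:R) ^+ 2 / c) *+ 'C(N, k)
    <= 2 ^+ N * expR (N%:R / (c - 8 * N%:R)).
Proof.
elim: N c => [|N IH] c hc.
  by rewrite big_ord1 /= !mul0r expr0 mul1r subrr expr0n /= mul0r.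
have N0 : 0 <= N%:R :> R by [].
have hc' : 8 * N%:R + 8 < c by move: hc; rewrite -natr1; lra.
have c0 : 0 < c by lra.
rewrite (sum_binS N (fun k => expR ((N.+1%:R - k.*2%:R) ^+ 2 / c))) -big_split /=.
apply: (@le_trans _ _ (\sum_(k < N.+1) (2 * expR (c^-1)) *
    (expR ((N%:R - k.*2%:R) ^+ 2 / (c - 8)) *+ 'C(N, k)))).
  apply: ler_sum => k _; rewrite -mulrnDl mulrnAr lerMn2r; apply/orP; right.
  have -> : N.+1%:R - k.*2%:R = (N%:R - k.*2%:R) + 1 :> R by rewrite -natr1; ring.
  have -> : N.+1%:R - k.+1.*2%:R = (N%:R - k.*2%:R) - 1 :> R.
    by rewrite doubleS -!natr1; ring.
  move: (N%:R - k.*2%:R) => s.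
  have -> : (s + 1) ^+ 2 / c = (c^-1 + s ^+ 2 / c) + 2 * s / c by ring.
  have -> : (s - 1) ^+ 2 / c = (c^-1 + s ^+ 2 / c) + - (2 * s / c) by ring.
  rewrite !(expRD (c^-1 + s ^+ 2 / c)) -mulrDr.
  apply: (le_trans (ler_wpM2l (expR_ge0 _) (cosh_le _))).
  rewrite [leLHS]mulrCA -[leRHS]mulrA -!expRD ler_wpM2l // ler_expR -addrA lerD2l.
  have -> : s ^+ 2 / c + 2 * (2 * s / c) ^+ 2 = s ^+ 2 * (c^-1 + 8 / c ^+ 2).
    by field; rewrite gt_eqF.
  rewrite ler_wpM2l ?sqr_ge0 // -subr_ge0.
  have -> : (c - 8)^-1 - (c^-1 + 8 / c ^+ 2) = 64 / (c ^+ 2 * (c - 8)).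
    by field; rewrite !gt_eqF //; lra.
  by rewrite divr_ge0 // mulr_ge0 ?sqr_ge0 //; lra.
rewrite -mulr_sumr; apply: (le_trans (ler_wpM2l _ (IH (c - 8) _))).
- by rewrite mulr_ge0 ?expR_ge0.
- by lra.
rewrite exprS -!mulrA ler_wpM2l // mulrCA ler_wpM2l ?exprn_ge0 // -expRD ler_expR.
have -> : c - 8 - 8 * N%:R = c - 8 * N.+1%:R by rewrite -natr1; ring.
set X := (c - 8 * N.+1%:R)^-1; have cX : c^-1 <= X.
  rewrite lef_pV2 ?posrE ?subr_gt0 ?hc //.
  by rewrite lerBlDr lerDl mulr_ge0.
by rewrite -natr1 mulrDl mul1r addrC lerD2l.
Qed.

End WalkMoments.

(** * Lower bound on the number of walks ending in the window *)

Lemma sum_window (kap N : nat) :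
  (\sum_(e : {ffun 'I_N -> bool}) window kap e =
   \sum_(k < N.+1 | in_window kap N k) 'C(N, k))%N.
Proof.
rewrite (@sum_ffun_bool nat) (eq_bigr (fun J : {set 'I_N} => nat_of_bool (in_window kap N #|J|))); last first.
  by move=> J _; rewrite window_set card_ord.
rewrite (@sum_card_set nat _ (fun k => nat_of_bool (in_window kap N k))) card_ord [RHS]big_mkcond.
by apply: eq_bigr => k _; case: (in_window _ _ _); rewrite ?mul0rn //= -mulr_natr mul1r natn.
Qed.

Lemma card_in_window_ge (kap N : nat) : (kap <= N)%N ->
  (kap <= #|[set a : 'I_N.+1 | in_window kap N a]%SET|)%N.
Proof.
move=> kN; pose f (i : 'I_kap) : 'I_N.+1 := inord ((N - kap).+1./2 + i).
have fE (i : 'I_kap) : f i = ((N - kap).+1./2 + i)%N :> nat.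
  by rewrite inordK //; have := ltn_ord i; lia.
rewrite -[leqLHS]card_ord -(@card_imset _ _ f); last first.
  by move=> i j /(congr1 val) /=; rewrite !fE => ij; apply: val_inj => /=; lia.
apply: subset_leq_card; apply/fintype.subsetP => _ /imsetP[i _ ->].
rewrite inE /in_window fE; have := ltn_ord i; lia.
Qed.

(** By Chebyshev at least half of the walks end within distance less than [kap + t]. That larger
    window has at most [kap + t] endpoints, of which at least [kap] lie in the small window, and
    unimodality gives these at least their proportional share. *)
Lemma window_mass (kap N t : nat) : (0 < kap)%N -> (2 * N < t ^ 2)%N ->
  (kap * 2 ^ N <= 2 * (kap + t) * \sum_(e : {ffun 'I_N -> bool}) window kap e)%N.
Proof.
move=> kap0 tN; rewrite sum_window; set A := (\sum_(k < _ | _) _)%N.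
have [Nk|kN] := ltnP N kap.
  have -> : A = (2 ^ N)%N.
    rewrite -sum_bin; apply: eq_bigl => k; rewrite /in_window.
    by have := ltn_ord k; lia.
  by rewrite leq_mul2r; apply/orP; right; lia.
(* With this [L] the large window has at most [L + 1 = kap + t] endpoints, while every endpoint
   outside it is still at distance at least [t]. *)
pose L := (kap + t).-1; pose B := (\sum_(k < N.+1 | in_window L N k && ~~ in_window kap N k) 'C(N, k))%N.
have kL : (kap <= L)%N by rewrite /L; case: (t) tN => [//|t' _]; lia.
have tL : (t <= L.+1)%N by rewrite /L; lia.
pose X := [set a : 'I_N.+1 | in_window kap N a]%SET.
pose Y := [set a : 'I_N.+1 | in_window L N a && ~~ in_window kap N a]%SET.
have XY : (#|X| + #|Y| <= L.+1)%N.
  apply: leq_trans (card_in_window L N); rewrite -cardsUI (_ : X :&: Y = finset.set0) ?cards0 ?addn0.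
    apply: subset_leq_card; apply/fintype.subsetP => a; rewrite !inE.
    by case/orP => [|/andP[]//]; rewrite /in_window; lia.
  by apply/setP => a; rewrite !inE; case: (in_window kap N a); rewrite /= ?andbF.
(* Every coefficient of the inner window dominates every coefficient of the ring around it; summing
   over all pairs compares the two averages. *)
have XB : (#|X| * B <= #|Y| * A)%N.
  rewrite -!sum1_card !big_distrl /=.
  rewrite (eq_bigl (fun a : 'I_N.+1 => in_window kap N a)); last by move=> a; rewrite inE.
  rewrite [leqRHS](eq_bigl (fun a : 'I_N.+1 => in_window L N a && ~~ in_window kap N a)); last by move=> a; rewrite inE.
  under eq_bigr => a _ do rewrite mul1n.
  under [leqRHS]eq_bigr => a _ do rewrite mul1n.
  rewrite exchange_big /=; apply: leq_sum => b /andP[_ bk]; apply: leq_sum => a ak.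
  apply: leq_bin_unimodal; [by rewrite -ltnS|by rewrite -ltnS|].
  by move: ak bk (ltn_ord a) (ltn_ord b); rewrite /in_window; lia.
have AB : (2 ^ N <= 2 * (A + B))%N.
  have cheb : ((2 ^ N - (A + B)) * t ^ 2 <= N * 2 ^ N)%N.
    rewrite [in leqLHS](_ : 2 ^ N = (A + B) + \sum_(k < N.+1 | ~~ in_window L N k) 'C(N, k))%N; last first.
      rewrite -sum_bin (bigID (fun k : 'I_N.+1 => in_window L N k)) /=; congr addn.
      rewrite (bigID (fun k : 'I_N.+1 => in_window kap N k)) /=; congr addn.
      by apply: eq_bigl => k; rewrite /in_window; lia.
    rewrite addKn -(ler_nat int) !natrM [(2 ^ N)%:R]natrX -(sum_bin_sqr int).
    rewrite natr_sum mulr_suml big_mkcond /=; apply: ler_sum => k _.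
    rewrite -[leRHS]mulr_natl; case: ifPn => kL'; last by rewrite mulr_ge0 ?sqr_ge0.
    rewrite ler_wpM2l // -?expr2 !natz; have := ltn_ord k; move: kL'; rewrite /in_window.
    move: (nat_of_ord k) => {}k kL' kN'.
    have [h|h] : (t%:Z <= N%:Z - k.*2%:Z) \/ (t%:Z <= k.*2%:Z - N%:Z) by lia.
      by rewrite ler_sqr // nnegrE; lia.
    by rewrite -[leRHS]sqrrN opprB ler_sqr // nnegrE; lia.
  by nia.
have Xk := card_in_window_ge kN; rewrite -/X in Xk.
have : (2 ^ N * #|X| <= 2 * (kap + t) * A)%N.
  have -> : (kap + t = L.+1)%N by rewrite /L; lia.
  by nia.
by move=> H; apply: leq_trans H; rewrite mulnC leq_mul2l Xk orbT.
Qed.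

(** * One-walk and two-walk window probabilities *)

Section WindowProbability.
Variables (R : realType) (kap : nat).

Definition win_prob (N : nat) : R :=
  (\sum_(e : {ffun 'I_N -> bool}) (window kap e)%:R) / 2 ^+ N.

(** The factor [(1 + rho * e_i * e'_i) / 4] is the law of a pair of uniform signs with correlation
    [rho], so this is the probability that both walks end in the window. *)
Definition win_corr (N : nat) (rho : R) : R :=
  (\sum_(e : {ffun 'I_N -> bool}) (window kap e)%:R *
     \sum_(e' : {ffun 'I_N -> bool}) (window kap e')%:R *
       \prod_i (1 + rho * ((-1) ^+ e i * (-1) ^+ e' i))) / 4 ^+ N.

Lemma win_prob_ge0 (N : nat) : 0 <= win_prob N.
Proof. by rewrite divr_ge0 ?exprn_ge0 // sumr_ge0. Qed.

Lemma win_prob_le (N : nat) : win_prob N <= kap.+1%:R / Num.sqrt N.+1%:R.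
Proof.
rewrite ler_pdivrMr ?exprn_gt0 //.
have := @biased_window R kap 'I_N 0 [ffun=> false] (lexx 0) ltr01.
rewrite subr0 mul1r card_ord => H; apply: le_trans (le_trans H _).
  by apply: ler_sum => e _; rewrite big1 ?mulr1 // => i _; rewrite mul0r addr0.
by rewrite -mulrA mulrC.
Qed.

(** [window_mass] is applied to the least [t] with [t ^ 2 > 2 N], which is at most
    [2 sqrt(N + 1) + 1]. Positivity for both parities of [N] rests on [kap >= 1]. *)
Lemma win_prob_gt0_inv_le (N : nat) : (0 < kap)%N ->
  0 < win_prob N /\ (win_prob N)^-1 <= 4 * (1 + Num.sqrt N.+1%:R / kap%:R).
Proof.
move=> kap0; have k0 : 0 < kap%:R :> R by rewrite ltr0n.
have ext : exists t, (2 * N < t ^ 2)%N.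
  by exists (2 * N).+1; rewrite -mulnn; apply: leq_pmulr.
case: (ex_minnP ext) => t tN tmin.
have t0 : (0 < t)%N by case: t tN {tmin}.
have t1 : (t.-1 ^ 2 <= 2 * N)%N.
  by rewrite leqNgt; apply/negP => /tmin; rewrite leqNgt prednK // leqnn.
set s := Num.sqrt _; have s0 : 0 < s by rewrite sqrtr_gt0.
have ts : t%:R <= 2 * s + 1.
  rewrite -(prednK t0) -natr1 lerD2r -ler_sqr ?nnegrE ?mulr_ge0 ?(ltW s0) //.
  rewrite exprMn sqr_sqrtr // -!natrX -natrM ler_nat (leq_trans t1) //; lia.
have M := window_mass kap0 tN.
have {}M : kap%:R * 2 ^+ N <= 2 * (kap%:R + t%:R) * (win_prob N * 2 ^+ N).
  rewrite /win_prob divfK ?expf_neq0 // -natr_sum -natrD -natrX -!natrM.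
  by rewrite ler_nat.
have {}M : kap%:R <= 2 * (kap%:R + t%:R) * win_prob N.
  by move: M; rewrite mulrA ler_pM2r // exprn_gt0.
have q0 : 0 < win_prob N.
  rewrite lt_neqAle win_prob_ge0 andbT; apply/eqP => q0.
  by move: M; rewrite -q0 mulr0 leNgt k0.
split => //; rewrite -(ler_pM2r q0) mulVf ?gt_eqF // -(ler_pM2r k0) mul1r.
apply: (le_trans M); rewrite [leRHS]mulrAC ler_wpM2r ?(ltW q0) //.
have -> : 4 * (1 + s / kap%:R) * kap%:R = 4 * (kap%:R + s) by field; rewrite gt_eqF.
have k1 : 1 <= kap%:R :> R by rewrite ler1n.
lra.
Qed.

Lemma signed_factor_ge0 (rho : R) (a b : bool) : `|rho| <= 1 ->
  0 <= 1 + rho * ((-1) ^+ a * (-1) ^+ b).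
Proof. by rewrite ler_norml => /andP[r1 r2]; case: a; case: b; rewrite /= ?expr0 ?expr1; lra. Qed.

Lemma sum_signed_product (N : nat) (rho : R) (e : {ffun 'I_N -> bool}) :
  \sum_(e' : {ffun 'I_N -> bool}) \prod_i (1 + rho * ((-1) ^+ e i * (-1) ^+ e' i)) = 2 ^+ N.
Proof.
rewrite -(bigA_distr_bigA (fun i b => 1 + rho * ((-1) ^+ e i * (-1) ^+ (b : bool)))) /=.
rewrite (eq_bigr (fun=> 2)) ?prodr_const ?card_ord // => i _.
by rewrite big_bool /= expr0 expr1; ring.
Qed.

Lemma win_corr_le_prob (N : nat) (rho : R) : `|rho| <= 1 -> win_corr N rho <= win_prob N.
Proof.
move=> r1; rewrite ler_pdivrMr ?exprn_gt0 // (_ : 4 = 2 * 2) ?exprMn; last by rewrite -natrM.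
rewrite mulrA divfK ?expf_neq0 // mulr_suml; apply: ler_sum => e _.
rewrite ler_wpM2l // -(sum_signed_product rho e); apply: ler_sum => e' _.
by rewrite ler_piMl ?prodr_ge0 // => [i _|]; [exact: signed_factor_ge0 | case: (window _ _)].
Qed.

Lemma win_corr_le_sqrt (N : nat) (rho : R) : 0 <= rho -> rho < 1 ->
  win_corr N rho <= win_prob N * (kap.+1%:R / Num.sqrt ((1 - rho) * N.+1%:R)).
Proof.
move=> r0 r1; rewrite ler_pdivrMr ?exprn_gt0 // (_ : 4 = 2 * 2) ?exprMn; last by rewrite -natrM.
have -> : win_prob N * (kap.+1%:R / Num.sqrt ((1 - rho) * N.+1%:R)) * (2 ^+ N * 2 ^+ N) =
  (\sum_(e : {ffun 'I_N -> bool}) (window kap e)%:R) *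
   (2 ^+ N * kap.+1%:R / Num.sqrt ((1 - rho) * N.+1%:R)).
  rewrite /win_prob; have : 2 ^+ N != 0 :> R by rewrite expf_neq0.
  by move: (2 ^+ N) ((Num.sqrt _)^-1) => x y x0; field.
rewrite mulr_suml; apply: ler_sum => e _; rewrite ler_wpM2l //.
by have := @biased_window R kap _ rho e r0 r1; rewrite card_ord.
Qed.

(** If [sqrt(N + 1) <= kap], then [win_prob] is at least [1/8] and [Q <= q <= 8 q ^ 2]. Otherwise
    [kap / sqrt(N + 1) <= 8 q], and [kap + 1 <= 2 kap] turns the anticoncentration bound into
    [16 q / sqrt(1 - rho)]. *)
Lemma win_corr_le_sqr (N : nat) (rho : R) : (0 < kap)%N -> 0 <= rho -> rho < 1 ->
  win_corr N rho <= 16 / Num.sqrt (1 - rho) * win_prob N ^+ 2.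
Proof.
move=> kap0 r0 r1; have [q0 qi] := win_prob_gt0_inv_le N kap0.
have k0 : 0 < kap%:R :> R by rewrite ltr0n.
have k1 : 1 <= kap%:R :> R by rewrite ler1n.
have a0 : 0 < 1 - rho by rewrite subr_gt0.
set al := Num.sqrt (1 - rho); have al0 : 0 < al by rewrite sqrtr_gt0.
have al1 : al <= 1 by rewrite -sqrtr1 ler_sqrt //; lra.
have ali : 1 <= al^-1 by rewrite -invr1 lef_pV2 ?posrE.
move: qi; set s := Num.sqrt _; have s0 : 0 < s by rewrite sqrtr_gt0.
move=> qi; rewrite expr2 mulrA.
have [sk|ks] := leP s kap%:R.
  apply: (le_trans (win_corr_le_prob _ _)); first by rewrite ger0_norm // ltW.
  rewrite -[leLHS]mul1r ler_wpM2r ?(ltW q0) //.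
  have : 1 <= 8 * win_prob N.
    rewrite -(ler_pM2r (_ : 0 < (win_prob N)^-1)) ?invr_gt0 // mul1r mulfK ?gt_eqF //.
    apply: (le_trans qi); have : s / kap%:R <= 1 by rewrite ler_pdivrMr // mul1r.
    by lra.
  move/le_trans; apply; rewrite ler_wpM2r ?(ltW q0) //; lra.
apply: (le_trans (win_corr_le_sqrt _ r0 r1)).
rewrite mulrC ler_wpM2r ?(ltW q0) //.
rewrite sqrtrM ?(ltW a0) // -/al -/s.
have qs : kap%:R / s <= 8 * win_prob N.
  rewrite -(ler_pM2r (_ : 0 < (win_prob N)^-1)) ?invr_gt0 // mulfK ?gt_eqF //.
  apply: (le_trans (ler_wpM2l _ qi)); first by rewrite divr_ge0 ?ltW.
  have -> : kap%:R / s * (4 * (1 + s / kap%:R)) = 4 * (kap%:R / s + 1).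
    by field; rewrite !gt_eqF.
  have : kap%:R / s <= 1 by rewrite ler_pdivrMr // mul1r ltW.
  by lra.
have -> : 16 / al * win_prob N = al^-1 * (2 * (8 * win_prob N)) by ring.
have -> : kap.+1%:R / (al * s) = al^-1 * (kap.+1%:R / s) by field; rewrite !gt_eqF.
apply: ler_wpM2l; first by rewrite invr_ge0 ltW.
apply: (@le_trans _ _ (2 * (kap%:R / s))); last by rewrite ler_wpM2l.
by rewrite mulrA ler_wpM2r ?invr_ge0 ?(ltW s0) // -natr1; lra.
Qed.

(** The Walsh (Fourier) coefficient at [J] of the indicator of the window. *)
Definition win_coef (N : nat) (J : {set 'I_N}) : R :=
  (\sum_(e : {ffun 'I_N -> bool}) (window kap e)%:R * \prod_(i in J) (-1) ^+ e i) / 2 ^+ N.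

Lemma win_corrE (N : nat) (rho : R) :
  win_corr N rho = \sum_(J : {set 'I_N}) rho ^+ #|J| * win_coef J ^+ 2.
Proof.
pose chi (J : {set 'I_N}) (e : {ffun 'I_N -> bool}) : R := \prod_(i in J) (-1) ^+ e i.
have prodE (e e' : {ffun 'I_N -> bool}) :
    \prod_i (1 + rho * ((-1) ^+ e i * (-1) ^+ e' i)) =
    \sum_(J : {set 'I_N}) rho ^+ #|J| * (chi J e * chi J e').
  under eq_bigr => i _ do rewrite addrC.
  rewrite bigA_distr; apply: eq_bigr => J _.
  rewrite -big_mkcond /= big_split /= prodr_const; congr (_ * _).
  by rewrite /chi -big_split.
rewrite /win_corr; under eq_bigr => e _ do under eq_bigr => e' _ do rewrite prodE mulr_sumr.
under eq_bigr => e _ do rewrite exchange_big mulr_sumr /=.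
rewrite exchange_big mulr_suml /=; apply: eq_bigr => J _.
rewrite /win_coef expr_div_n -exprM mulnC exprM (_ : 2 ^+ 2 = 4); last by rewrite -natrX.
rewrite mulrA; congr (_ / _); rewrite expr2 big_distrlr /= mulr_sumr.
apply: eq_bigr => e _; rewrite !mulr_sumr; apply: eq_bigr => e' _; rewrite /chi; ring.
Qed.

(** Flipping all signs preserves the window and negates every odd Walsh character. *)
Lemma win_coef_odd (N : nat) (J : {set 'I_N}) : odd #|J| -> win_coef J = 0.
Proof.
move=> oJ; rewrite /win_coef; set S := \sum_e _; suff S0 : S = - S.
  have -> : S = 0 by lra.
  by rewrite mul0r.
pose neg (e : {ffun 'I_N -> bool}) : {ffun 'I_N -> bool} := [ffun i => ~~ e i].
have negK : involutive neg by move=> e; apply/ffunP => i; rewrite !ffunE negbK.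
rewrite {1}/S (reindex_inj (inv_inj negK)) /= -sumrN; apply: eq_bigr => e _.
have sN i : (-1) ^+ neg e i = - (-1) ^+ e i :> R.
  by rewrite ffunE; case: (e i); rewrite /= ?expr0 ?expr1 ?opprK.
have -> : window kap (neg e) = window kap e.
  rewrite /window (_ : walk (neg e) = - walk e) ?normrN //.
  rewrite /walk -sumrN; apply: eq_bigr => i _.
  by rewrite ffunE; case: (e i); rewrite /= ?expr0 ?expr1 ?opprK.
under eq_bigr => i _ do rewrite sN.
by rewrite prodrN -signr_odd oJ expr1 mulN1r mulrN.
Qed.

(* Only the sets of even cardinality contribute to [win_corr], so the correlation in excess of
   [win_prob ^+ 2] is at least quadratically small in [rho]. *)
Lemma win_corr_le (N : nat) (rho rho0 : R) : (0 < kap)%N -> 0 < rho0 -> rho0 < 1 ->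
  `|rho| <= rho0 ->
  win_corr N rho <= win_prob N ^+ 2 * (1 + 16 / Num.sqrt (1 - rho0) / rho0 ^+ 2 * rho ^+ 2).
Proof.
move=> kap0 r0 r1 rr.
have H : win_corr N rho <= win_prob N ^+ 2 + (rho / rho0) ^+ 2 * win_corr N rho0.
  rewrite !win_corrE (bigD1 finset.set0) //= cards0 expr0 mul1r; apply: lerD.
    rewrite le_eqVlt; apply/orP; left; apply/eqP; congr (_ ^+ 2).
    by rewrite /win_coef /win_prob; congr (_ / _); apply: eq_bigr => e _; rewrite big_set0 mulr1.
  rewrite mulr_sumr [leRHS](bigD1 finset.set0) //=; apply: ler_wpDl.
    by rewrite mulr_ge0 ?sqr_ge0 // mulr_ge0 ?sqr_ge0 ?exprn_ge0 // ltW.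
  apply: ler_sum => J J0.
  case: (boolP (odd #|J|)) => [oJ|eJ]; first by rewrite win_coef_odd // expr0n /= !mulr0.
  rewrite mulrA ler_wpM2r ?sqr_ge0 //.
  (* For [#|J| = 2 + 2k], the factor [(rho / rho0) ^ 2] is split off and [rho ^ (2k) <= rho0 ^ (2k)]
     bounds the rest. *)
  have [k ->] : exists k, #|J| = (2 + k.*2)%N.
    exists (#|J| - 2)./2.
    move: eJ J0.
    rewrite -cards_eq0.
    move: #|J| => c eJ J0.
    clear -eJ J0.
    lia.
  rewrite !exprD expr_div_n mulrA divfK ?expf_neq0 ?gt_eqF // ler_wpM2l ?sqr_ge0 //.
  rewrite -!muln2 mulnC !exprM; apply: lerXn2r; rewrite ?nnegrE ?sqr_ge0 //.
  by rewrite -[leLHS]ger0_norm ?sqr_ge0 // normrX; apply: lerXn2r; rewrite ?nnegrE // ltW.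
apply: (le_trans H); rewrite mulrDr mulr1 lerD2l.
apply: (le_trans (ler_wpM2l _ (win_corr_le_sqr N kap0 (ltW r0) r1))); first exact: sqr_ge0.
rewrite le_eqVlt; apply/orP; left; apply/eqP.
have : Num.sqrt (1 - rho0) != 0 by rewrite gt_eqF // sqrtr_gt0 subr_gt0.
by move: (Num.sqrt _) => x x0; field; rewrite x0 gt_eqF.
Qed.

End WindowProbability.

(** * Poisson rows with given sum as occupation vectors *)

Section Occupation.
Variable n : nat.

Definition occ (N : nat) (g : {ffun 'I_N -> 'I_n}) : {ffun 'I_n -> nat} :=
  [ffun j => \sum_l (g l == j)]%N.

Definition ffun_cons (T : Type) (N : nat) (a : T) (g : {ffun 'I_N -> T}) : {ffun 'I_N.+1 -> T} :=
  [ffun l => oapp g a (unlift ord0 l)].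

Lemma sum_ffun_ordS (T : finType) (N : nat) (H : {ffun 'I_N.+1 -> T} -> nat) :
  (\sum_g H g = \sum_a \sum_(g : {ffun 'I_N -> T}) H (ffun_cons a g))%N.
Proof.
rewrite pair_big (reindex (fun p : T * {ffun 'I_N -> T} => ffun_cons p.1 p.2)) //=.
exists (fun g => (g ord0, [ffun l => g (lift ord0 l)])) => [[a g] _|g _] /=.
  by congr pair; [rewrite ffunE unlift_none | apply/ffunP => l; rewrite !ffunE liftK].
apply/ffunP => l; rewrite ffunE; case: unliftP => [k ->|->] //=; by rewrite ffunE.
Qed.

Lemma occ_cons (N : nat) (a : 'I_n) (g : {ffun 'I_N -> 'I_n}) (j : 'I_n) :
  occ (ffun_cons a g) j = ((a == j) + occ g j)%N.
Proof.
rewrite !ffunE big_ord_recl ffunE unlift_none /=; congr addn.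
by apply: eq_bigr => l _; rewrite ffunE liftK.
Qed.

Lemma sum_occ (N : nat) (g : {ffun 'I_N -> 'I_n}) : (\sum_j occ g j = N)%N.
Proof.
under eq_bigr => j _ do rewrite ffunE.
rewrite exchange_big /= (eq_bigr (fun=> 1%N)) ?sum1_card ?card_ord // => l _.
rewrite (bigD1 (g l)) //= eqxx big1 // => j; by rewrite eq_sym => /negbTE ->.
Qed.

(** The multinomial coefficient, cleared of denominators. Removing the first value [a] lowers [x a]
    by one, and the resulting factors [x a] add up to [N + 1]. *)
Lemma card_occ (N : nat) (x : {ffun 'I_n -> nat}) : (\sum_j x j = N)%N ->
  ((\sum_(g : {ffun 'I_N -> 'I_n}) (occ g == x)) * \prod_j (x j)`! = N`!)%N.
Proof.
elim: N x => [|N IH] x xN.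
  have x0 j : x j = 0%N.
    by apply/eqP; move/eqP: xN; rewrite sum_nat_eq0 => /forallP/(_ j).
  rewrite [X in (_ * X)%N]big1 => [|j _]; last by rewrite x0.
  rewrite muln1 (eq_bigr (fun=> 1%N)) => [|g _].
    by rewrite sum1_card card_ffun !card_ord expn0.
  by rewrite (_ : occ g == x) //; apply/eqP/ffunP => j; rewrite ffunE big_ord0 x0.
transitivity ((\sum_j x j) * N`!)%N; last by rewrite xN factS.
rewrite sum_ffun_ordS !big_distrl /=.
apply: eq_bigr => a _; have [xa0|xa] := posnP (x a).
  rewrite xa0 mul0n big1 // => g _; apply/eqP; rewrite eqb0; apply/eqP => E.
  by have := xa0; rewrite -E occ_cons eqxx.
pose y : {ffun 'I_n -> nat} := [ffun j => x j - (a == j)]%N.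
have yN : (\sum_j y j = N)%N.
  suff yS : (\sum_j y j + 1 = \sum_j x j)%N by move: yS; rewrite xN addn1 => -[].
  rewrite (bigD1 a) //= [RHS](bigD1 a) //= ffunE eqxx addnAC subnK //; congr addn.
  by apply: eq_bigr => j /negbTE ja; rewrite ffunE eq_sym ja subn0.
have -> : (\prod_j (x j)`! = x a * \prod_j (y j)`!)%N.
  rewrite (bigD1 a) //= [in RHS](bigD1 a) //= ffunE eqxx subn1 mulnA.
  rewrite -[in LHS](prednK xa) factS prednK //; congr muln.
  by apply: eq_bigr => j /negbTE ja; rewrite ffunE eq_sym ja subn0.
rewrite mulnCA -(IH y yN); congr (_ * (_ * _))%N.
apply: eq_bigr => g _; congr nat_of_bool; apply/eqP/eqP => [E|gy].
  by apply/ffunP => j; rewrite [RHS]ffunE -E occ_cons addKn.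
apply/ffunP => j; rewrite occ_cons gy ffunE.
by case: eqP => [<-|_] /=; rewrite ?subn0 // subnKC.
Qed.

End Occupation.

Section RowLaw.
Variables (R : realType) (n : nat).

Definition fnat (K : nat) (y : {ffun 'I_n -> 'I_K}) : {ffun 'I_n -> nat} :=
  [ffun j => nat_of_ord (y j)].

(** The product of the Poisson weights is a constant times the multinomial coefficient of the row,
    which [card_occ] reads as a number of maps [g]. The last indicator is the trace of the
    truncation at [K]. *)
Lemma poisson_row (lambda : R) (K N : nat) (F : {ffun 'I_n -> nat} -> R) : 0 < lambda ->
  \sum_(y : {ffun 'I_n -> 'I_K} | (\sum_j y j == N)%N) (\prod_j poisson_pmf lambda (y j)) * F (fnat y)
  = lambda ^+ N / N`!%:R * expR (- (n%:R * lambda)) *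
    \sum_(g : {ffun 'I_N -> 'I_n}) F (occ g) * [forall j, occ g j < K]%N%:R.
Proof.
move=> l0; set c := _ * expR _.
have prodE (y : {ffun 'I_n -> 'I_K}) : (\sum_j y j == N)%N ->
    \prod_j poisson_pmf lambda (y j) = c * \sum_(g : {ffun 'I_N -> 'I_n}) (occ g == fnat y)%:R.
  move=> /eqP yN; have yN' : (\sum_j fnat y j = N)%N.
    by rewrite -[RHS]yN; apply: eq_bigr => j _; rewrite ffunE.
  have := card_occ yN' => /(congr1 (fun k => k%:R : R)); rewrite natrM natr_sum => E.
  have p0 : \prod_j (fnat y j)`!%:R != 0 :> R.
    by apply/prodf_neq0 => j _; rewrite pnatr_eq0 -lt0n fact_gt0.
  move: E; rewrite natr_prod => /(canRL (mulfK p0)) ->; rewrite /c.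
  rewrite (eq_bigr (fun j => (lambda ^+ y j * expR (- lambda)) * ((fnat y j)`!%:R)^-1)); last first.
    by move=> j _; rewrite /poisson_pmf l0 ffunE mulrAC.
  rewrite big_split big_split /= prodfV prodr_const card_ord.
  have -> : \prod_j lambda ^+ y j = lambda ^+ N.
    by rewrite -yN (big_morph _ (exprD lambda) (expr0 lambda)).
  rewrite -mulrN expRM_natl; have f0 : N`!%:R != 0 :> R by rewrite pnatr_eq0 -lt0n fact_gt0.
  by move: f0 (expR _ ^+ _) => f0 z; field; rewrite f0 p0.
rewrite (eq_bigr (fun y : {ffun 'I_n -> 'I_K} => \sum_(g : {ffun 'I_N -> 'I_n})
    c * (F (occ g) * (occ g == fnat y)%:R))); last first.
  move=> y yN; rewrite prodE // -mulrA mulr_suml mulr_sumr; apply: eq_bigr => g _.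
  by congr (_ * _); case: eqP => [->|]; rewrite ?mul1r ?mulr1 ?mul0r ?mulr0.
rewrite exchange_big /= mulr_sumr; apply: eq_bigr => g _; rewrite -mulr_sumr -mulr_sumr.
congr (_ * (_ * _)); case: forallP => [gK|gK] /=.
  pose y : {ffun 'I_n -> 'I_K} := [ffun j => Ordinal (gK j)].
  have yE : fnat y = occ g by apply/ffunP => j; rewrite ffunE ffunE.
  rewrite (bigD1 y) /=; last first.
    rewrite -(sum_occ g) -yE; apply/eqP; apply: eq_bigr => j _; by rewrite [RHS]ffunE.
  rewrite yE eqxx big1 ?addr0 // => z /andP[_ zy]; case: eqP => // gz; case/negP: zy.
  apply/eqP/ffunP => j; apply: val_inj => /=.
  have E : occ g j = z j by rewrite gz ffunE.
  by rewrite -E (_ : y j = Ordinal (gK j)) ?ffunE.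
rewrite big1 // => y _; case: eqP => // gy; case: gK => j.
by rewrite gy ffunE.
Qed.

End RowLaw.

(** * Partial sums of Poisson moments *)

Section PoissonSums.
Variables (R : realType) (M : R).
Hypothesis M_gt0 : 0 < M.

Lemma poisson_pmfS (k : nat) : poisson_pmf M k.+1 * k.+1%:R = M * poisson_pmf M k.
Proof.
rewrite /poisson_pmf M_gt0 factS natrM exprS; have k0 : k`!%:R != 0 :> R.
  by rewrite pnatr_eq0 -lt0n fact_gt0.
have kS : k.+1%:R != 0 :> R by rewrite pnatr_eq0.
by move: (k.+1%:R) (k`!%:R) kS k0 => x y x0 y0; field; rewrite x0 y0.
Qed.

Lemma sum_poisson_le1 (L : nat) : \sum_(k < L) poisson_pmf M k <= 1.
Proof.
have -> : \sum_(k < L) poisson_pmf M k = series (exp_coeff M) L * expR (- M).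
  rewrite /series /= big_mkord mulr_suml; apply: eq_bigr => k _.
  by rewrite /poisson_pmf M_gt0.
rewrite expRN ler_pdivrMr ?expR_gt0 // mul1r.
apply: nondecreasing_cvgn_le; last exact: is_cvg_series_exp_coeff.
apply/nondecreasing_seqP => k; rewrite /series /= big_nat_recr //= lerDl.
by apply: exp_coeff_ge0; rewrite ltW.
Qed.

Lemma sum_poisson_mean (L : nat) : \sum_(k < L) poisson_pmf M k * k%:R <= M.
Proof.
case: L => [|L]; first by rewrite big_ord0 ltW.
rewrite big_ord_recl mulr0 add0r.
under eq_bigr => k _ do rewrite lift0 poisson_pmfS.
by rewrite -mulr_sumr ler_piMr ?sum_poisson_le1 // ltW.
Qed.

(** Since [poisson_pmf M k / (k + 1) = poisson_pmf M (k + 1) / M], the sum is a shifted partial sum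
    of the total mass. *)
Lemma sum_poisson_inv (L : nat) : \sum_(k < L) poisson_pmf M k / k.+1%:R <= M^-1.
Proof.
rewrite -[leRHS]mul1r ler_pdivlMr // mulr_suml.
apply: le_trans (sum_poisson_le1 L.+1); rewrite big_ord_recl; apply: ler_wpDl.
  exact: poisson_pmf_ge0.
apply: ler_sum => k _; rewrite lift0 mulrAC [_ * M]mulrC -poisson_pmfS mulfK //.
Qed.

Lemma sum_poisson_inv_sqrt (L : nat) :
  \sum_(k < L) poisson_pmf M k / Num.sqrt k.+1%:R <= (Num.sqrt M)^-1.
Proof.
set s := Num.sqrt M; have s0 : 0 < s by rewrite sqrtr_gt0.
apply: (@le_trans _ _ ((s * (\sum_(k < L) poisson_pmf M k / k.+1%:R)
    + s^-1 * (\sum_(k < L) poisson_pmf M k)) / 2)).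
  rewrite !mulr_sumr -big_split mulr_suml /=; apply: ler_sum => k _.
  have := ler_wpM2l (poisson_pmf_ge0 M k) (inv_sqrt_le s0 (ltr0Sn R k)).
  move=> /le_trans; apply; rewrite le_eqVlt; apply/orP; left; apply/eqP; ring.
have h1 : s * (\sum_(k < L) poisson_pmf M k / k.+1%:R) <= s^-1.
  have -> : s^-1 = s * M^-1.
    by rewrite -[M]sqr_sqrtr ?(ltW M_gt0) // -/s expr2 invfM mulrA mulfV ?mul1r // gt_eqF.
  by rewrite ler_wpM2l ?sum_poisson_inv // ltW.
have h2 : s^-1 * (\sum_(k < L) poisson_pmf M k) <= s^-1.
  by rewrite ler_piMr ?sum_poisson_le1 // invr_ge0 ltW.
by rewrite ler_pdivrMr // [_ * 2]mulrDr mulr1 lerD.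
Qed.

End PoissonSums.

(** * Signed row sums as correlated walks *)

Section RowSigns.
Variables (R : realType) (n : nat).

Definition rowdot (u : {ffun 'I_n -> bool}) (x : {ffun 'I_n -> nat}) : int :=
  \sum_j (x j)%:Z * (-1) ^+ u j.

Definition row_ok (kap : nat) (u : {ffun 'I_n -> bool}) (x : {ffun 'I_n -> nat}) : bool :=
  `|rowdot u x| <= kap%:Z.

Definition overlap (u v : {ffun 'I_n -> bool}) : R :=
  (\sum_j (-1) ^+ u j * (-1) ^+ v j) / n%:R.

Lemma row_ok_occ (kap N : nat) (u : {ffun 'I_n -> bool}) (g : {ffun 'I_N -> 'I_n}) :
  row_ok kap u (occ g) = window kap [ffun l => u (g l)].
Proof.
rewrite /row_ok /window; congr (`|_| <= _); rewrite /rowdot /walk.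
transitivity (\sum_j \sum_(l < N) (g l == j)%:Z * (-1) ^+ u j : int).
  apply: eq_bigr => j _; rewrite ffunE -mulr_suml; congr (_ * _).
  by rewrite -natz natr_sum; apply: eq_bigr => l _; rewrite natz.
rewrite exchange_big /=; apply: eq_bigr => l _.
rewrite (bigD1 (g l)) //= eqxx mul1r big1 ?addr0 ?ffunE // => j jl.
by rewrite eq_sym (negbTE jl) mul0r.
Qed.

Lemma walk_intr (u : {ffun 'I_n -> bool}) : (walk u)%:~R = \sum_j (-1) ^+ u j :> R.
Proof. by rewrite /walk rmorph_sum /=; apply: eq_bigr => j _; rewrite rmorphXn /= rmorphN. Qed.

(** For a column [j] the indicator of [(u_j, v_j) = (a, b)] is [(1 + a u_j)(1 + b v_j) / 4] in terms
    of signs. Summed over [j], the linear terms vanish because [u] and [v] are balanced, and the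
    mixed term gives the overlap. *)
Lemma sum_comp_signs (N : nat) (u v : {ffun 'I_n -> bool})
    (H : {ffun 'I_N -> bool} -> {ffun 'I_N -> bool} -> R) :
  (0 < n)%N -> walk u = 0 -> walk v = 0 ->
  \sum_(g : {ffun 'I_N -> 'I_n}) H [ffun l => u (g l)] [ffun l => v (g l)] =
  n%:R ^+ N / 4 ^+ N *
    \sum_e \sum_e' H e e' * \prod_i (1 + overlap u v * ((-1) ^+ e i * (-1) ^+ e' i)).
Proof.
move=> n0 u0 v0.
transitivity (\sum_e \sum_e' H e e' *
   \sum_(g : {ffun 'I_N -> 'I_n}) \prod_l ((u (g l) == e l) && (v (g l) == e' l))%:R).
  have -> : \sum_(g : {ffun 'I_N -> 'I_n}) H [ffun l => u (g l)] [ffun l => v (g l)] =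
    \sum_e \sum_e' \sum_(g : {ffun 'I_N -> 'I_n}) H e e' *
      \prod_l ((u (g l) == e l) && (v (g l) == e' l))%:R.
    under [RHS]eq_bigr => e _ do rewrite exchange_big /=.
    rewrite [RHS]exchange_big /=; apply: eq_bigr => g _.
    rewrite (bigD1 [ffun l => u (g l)]) //= [X in _ + X]big1 ?addr0; last first.
      move=> e ne; apply: big1 => e' _; have [l nl] : exists l, u (g l) != e l.
        apply/existsP; apply: contraNT ne => /existsPn eq; apply/eqP/ffunP => l.
        by rewrite ffunE; apply/eqP; rewrite eq_sym -[_ == _]negbK eq.
      by rewrite (bigD1 l) //= (negbTE nl) mul0r mulr0.
    rewrite (bigD1 [ffun l => v (g l)]) //= [X in _ + X]big1 ?addr0; last first.
      move=> e ne; have [l nl] : exists l, v (g l) != e l.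
        apply/existsP; apply: contraNT ne => /existsPn eq; apply/eqP/ffunP => l.
        by rewrite ffunE; apply/eqP; rewrite eq_sym -[_ == _]negbK eq.
      by rewrite (bigD1 l) //= (negbTE nl) andbF mul0r mulr0.
    by rewrite big1 ?mulr1 // => l _; rewrite !ffunE !eqxx.
  by apply: eq_bigr => e _; apply: eq_bigr => e' _; rewrite mulr_sumr.
rewrite mulr_sumr; apply: eq_bigr => e _; rewrite mulr_sumr; apply: eq_bigr => e' _.
rewrite -(bigA_distr_bigA (fun l j => ((u j == e l) && (v j == e' l))%:R)) mulrCA; congr (_ * _).
have -> : n%:R ^+ N / 4 ^+ N = \prod_(l < N) (n%:R / 4) :> R.
  by rewrite prodr_const card_ord expr_div_n.
rewrite -big_split /=.
apply: eq_bigr => l _; set a : R := (-1) ^+ e l; set b : R := (-1) ^+ e' l.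
rewrite (eq_bigr (fun j => (1 + a * (-1) ^+ u j + b * (-1) ^+ v j
   + a * b * ((-1) ^+ u j * (-1) ^+ v j)) / 4)); last first.
  by move=> j _; rewrite /a /b; case: (u j); case: (v j); case: (e l); case: (e' l);
    rewrite /= ?expr0 ?expr1; field.
rewrite -mulr_suml !big_split /= -!mulr_sumr -!walk_intr u0 v0 !mulr0 !addr0 sumr_const card_ord.
by rewrite /overlap; field; rewrite pnatr_eq0 -lt0n.
Qed.

End RowSigns.

(** * Truncated Poisson rows *)

Section TruncatedRows.
Variables (R : realType) (n K : nat) (lambda : R).
Hypotheses (n_gt0 : (0 < n)%N) (lambda_gt0 : 0 < lambda).

Definition row_pmf (y : {ffun 'I_n -> 'I_K}) : R := \prod_j poisson_pmf lambda (y j).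

Definition row_sum (y : {ffun 'I_n -> 'I_K}) : nat := (\sum_j y j)%N.

Lemma row_pmf_ge0 (y : {ffun 'I_n -> 'I_K}) : 0 <= row_pmf y.
Proof. by apply: prodr_ge0 => j _; exact: poisson_pmf_ge0. Qed.

Let M : R := n%:R * lambda.

Lemma row_mean_gt0 : 0 < M.
Proof. by rewrite mulr_gt0 // ltr0n. Qed.

Lemma row_factorE (N : nat) : lambda ^+ N / N`!%:R * expR (- M) * n%:R ^+ N = poisson_pmf M N.
Proof. by rewrite /poisson_pmf row_mean_gt0 /M exprMn; ring. Qed.

(** Truncation can only lose mass, so this holds for every [N] and serves the upper bound on the
    first moment. Chebyshev needs exact moments, which the next lemma gives for [N < K], where no
    entry can reach [K]. *)
Lemma row_pmf_sum_le (N : nat) (c : R) (F : {ffun 'I_n -> nat} -> R) :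
  (forall x, 0 <= F x) -> \sum_(g : {ffun 'I_N -> 'I_n}) F (occ g) <= n%:R ^+ N * c ->
  \sum_(y | row_sum y == N) row_pmf y * F (fnat y) <= poisson_pmf M N * c.
Proof.
move=> F0 Fc; rewrite poisson_row // -row_factorE -[leRHS]mulrA; apply: ler_wpM2l.
  by rewrite mulr_ge0 ?expR_ge0 // mulr_ge0 ?invr_ge0 // exprn_ge0 // ltW.
apply: le_trans Fc; apply: ler_sum => g _.
by rewrite ler_piMr //; case: [forall _, _].
Qed.

Lemma row_pmf_sum_eq (N : nat) (c : R) (F : {ffun 'I_n -> nat} -> R) : (N < K)%N ->
  \sum_(g : {ffun 'I_N -> 'I_n}) F (occ g) = n%:R ^+ N * c ->
  \sum_(y | row_sum y == N) row_pmf y * F (fnat y) = poisson_pmf M N * c.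
Proof.
move=> NK Fc; rewrite poisson_row // -row_factorE -[RHS]mulrA -Fc; congr (_ * _).
apply: eq_bigr => g _; have -> : [forall j, (occ g j < K)%N]; last by rewrite mulr1.
apply/forallP => j; apply: leq_ltn_trans NK.
by rewrite -[leqRHS](sum_occ g) (bigD1 j) //= leq_addr.
Qed.

Lemma sum_occ_window (kap N : nat) (u : {ffun 'I_n -> bool}) : walk u = 0 ->
  \sum_(g : {ffun 'I_N -> 'I_n}) (row_ok kap u (occ g))%:R = n%:R ^+ N * win_prob R kap N.
Proof.
move=> u0; under eq_bigr => g _ do rewrite row_ok_occ.
(* The second vector is a dummy, taken equal to [u]; summing over [e'] gives [2 ^ N] whatever the
   overlap. *)
rewrite (sum_comp_signs (fun e _ => (window kap e)%:R) n_gt0 u0 u0).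
under eq_bigr => e _ do rewrite -mulr_sumr sum_signed_product.
rewrite -mulr_suml /win_prob (_ : 4 = 2 * 2) ?exprMn; last by rewrite -natrM.
have : 2 ^+ N != 0 :> R by rewrite expf_neq0.
by move: (2 ^+ N) => x x0; field.
Qed.

Lemma sum_occ_window2 (kap N : nat) (u v : {ffun 'I_n -> bool}) : walk u = 0 -> walk v = 0 ->
  \sum_(g : {ffun 'I_N -> 'I_n}) (row_ok kap u (occ g))%:R * (row_ok kap v (occ g))%:R
    = n%:R ^+ N * win_corr kap N (overlap R u v).
Proof.
move=> u0 v0; under eq_bigr => g _ do rewrite !row_ok_occ.
rewrite (sum_comp_signs (fun e e' => (window kap e)%:R * (window kap e')%:R) n_gt0 u0 v0).
rewrite /win_corr [in RHS]mulrA [RHS]mulrAC; congr (_ * _).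
by apply: eq_bigr => e _; rewrite mulr_sumr; apply: eq_bigr => e' _; rewrite mulrA.
Qed.

Lemma sum_row_pmf (N : nat) : (N < K)%N ->
  \sum_(y | row_sum y == N) row_pmf y = poisson_pmf M N.
Proof.
move=> NK; rewrite -[RHS]mulr1 -(@row_pmf_sum_eq N 1 (fun=> 1)) //.
  by apply: eq_bigr => y _; rewrite mulr1.
by rewrite sumr_const card_ffun !card_ord natrX mulr1.
Qed.

Lemma sum_row_pmf_le (N : nat) : \sum_(y | row_sum y == N) row_pmf y <= poisson_pmf M N.
Proof.
rewrite -[leRHS]mulr1 (eq_bigr (fun y => row_pmf y * 1)); last by move=> y _; rewrite mulr1.
apply: (@row_pmf_sum_le N 1 (fun=> 1)) => //.
by rewrite sumr_const card_ffun !card_ord natrX mulr1.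
Qed.

Lemma sum_by_row_sum (F : {ffun 'I_n -> 'I_K} -> R) :
  \sum_y F y = \sum_(N < (n * K).+1) \sum_(y | row_sum y == N) F y.
Proof.
have yb y : (row_sum y < (n * K).+1)%N.
  rewrite ltnS /row_sum; apply: (@leq_trans (\sum_(j < n) K)%N).
    by apply: leq_sum => j _; exact: ltnW.
  by rewrite sum_nat_const card_ord.
rewrite (partition_big (fun y => Ordinal (yb y)) xpredT) //=.
Qed.

Lemma sum_row_pmf_le1 : \sum_y row_pmf y <= 1.
Proof.
rewrite sum_by_row_sum; apply: le_trans (sum_poisson_le1 row_mean_gt0 (n * K).+1).
by apply: ler_sum => N _; exact: sum_row_pmf_le.
Qed.

Lemma sum_row_pmf_mean : \sum_y row_pmf y * (row_sum y)%:R <= M.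
Proof.
rewrite sum_by_row_sum; apply: le_trans (sum_poisson_mean row_mean_gt0 (n * K).+1).
apply: ler_sum => N _; rewrite (eq_bigr (fun y => row_pmf y * N%:R)); last by move=> y /eqP ->.
by rewrite -mulr_suml ler_wpM2r // sum_row_pmf_le.
Qed.

Lemma sum_row_ok_le (kap : nat) (u : {ffun 'I_n -> bool}) : walk u = 0 ->
  \sum_y row_pmf y * (row_ok kap u (fnat y))%:R <= Num.min 1 (kap.+1%:R / Num.sqrt M).
Proof.
move=> u0; rewrite le_min; apply/andP; split.
  apply: le_trans sum_row_pmf_le1; apply: ler_sum => y _.
  by rewrite ler_piMr ?row_pmf_ge0 //; case: (row_ok _ _ _).
rewrite sum_by_row_sum.
apply: (@le_trans _ _ (\sum_(N < (n * K).+1) kap.+1%:R * (poisson_pmf M N / Num.sqrt N.+1%:R))).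
  apply: ler_sum => N _.
  apply: (le_trans (@row_pmf_sum_le N (win_prob R kap N) (fun x => (row_ok kap u x)%:R) _ _)) => //.
    by rewrite sum_occ_window.
  rewrite [leRHS]mulrCA; apply: ler_wpM2l; [exact: poisson_pmf_ge0 | exact: win_prob_le].
by rewrite -mulr_sumr ler_wpM2l // sum_poisson_inv_sqrt // row_mean_gt0.
Qed.

End TruncatedRows.

(** * Second moment for prescribed row sums *)

Section SecondMoment.
Variables (R : realType) (m n K kap : nat) (lambda : R).
Hypotheses (n_gt0 : (0 < n)%N) (lambda_gt0 : 0 < lambda) (kap_gt0 : (0 < kap)%N).

Notation fam := {ffun 'I_m -> {ffun 'I_n -> 'I_K}}.
Notation signs := {ffun 'I_n -> bool}.

Definition fam_pmf (f : fam) : R := \prod_i row_pmf lambda (f i).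

Definition fam_ok (u : signs) (f : fam) : bool := [forall i, row_ok kap u (fnat (f i))].

Definition fam_bad (f : fam) : bool := [forall u : signs, (walk u == 0) ==> ~~ fam_ok u f].

Definition balanced_num : nat := #|[pred u : signs | walk u == 0]|.

Lemma fam_pmf_ge0 (f : fam) : 0 <= fam_pmf f.
Proof. by apply: prodr_ge0 => i _; exact: row_pmf_ge0. Qed.

Lemma fam_okE (u : signs) (f : fam) :
  (fam_ok u f)%:R = \prod_i (row_ok kap u (fnat (f i)))%:R :> R.
Proof.
rewrite /fam_ok; case: forallP => [H|H]; first by rewrite big1 // => i _; rewrite H.
have [i /negbTE ni] : exists i, ~~ row_ok kap u (fnat (f i)).
  by apply/existsP; rewrite -negb_forall; apply/forallP.
by rewrite (bigD1 i) //= ni mul0r.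
Qed.

Let M : R := n%:R * lambda.

Definition has_row_sums (N : 'I_m -> nat) (i : 'I_m) : pred {ffun 'I_n -> 'I_K} :=
  [pred y | row_sum y == N i].

Lemma sum_fam_pmf (N : 'I_m -> nat) (G : 'I_m -> {ffun 'I_n -> 'I_K} -> R) :
  \sum_(f in family (has_row_sums N)) fam_pmf f * (\prod_i G i (f i)) =
  \prod_i \sum_(y | row_sum y == N i) row_pmf lambda y * G i y.
Proof.
rewrite (bigA_distr_big_dep (has_row_sums N) (fun i y => row_pmf lambda y * G i y)).
by apply: eq_bigr => f _; rewrite big_split.
Qed.

(** Chebyshev's inequality pointwise: with [Z] the number of admissible balanced vectors, the right
    side is [(Z - mu) ^ 2 / mu ^ 2], and [Z = 0] on a bad family. *)
Lemma fam_bad_le (f : fam) (mu : R) : 0 < mu ->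
  (fam_bad f)%:R <= mu ^- 2 * ((\sum_(u : signs | walk u == 0) \sum_(v : signs | walk v == 0)
     (fam_ok u f)%:R * (fam_ok v f)%:R)
   - 2 * mu * (\sum_(u : signs | walk u == 0) (fam_ok u f)%:R) + mu ^+ 2).
Proof.
move=> mu0; rewrite -big_distrlr /=; set Z := \sum_(u | _) _.
have -> : Z * Z - 2 * mu * Z + mu ^+ 2 = (Z - mu) ^+ 2 by ring.
case: (boolP (fam_bad f)) => [|_]; last by rewrite mulr_ge0 ?sqr_ge0 // invr_ge0 sqr_ge0.
move=> /forallP bad; have -> : Z = 0.
  by rewrite /Z big1 // => u u0; have := bad u; rewrite u0 => /negbTE ->.
by rewrite sub0r sqrrN mulVf // expf_neq0 // gt_eqF.
Qed.

Lemma second_moment (N : 'I_m -> nat) : (forall i, N i < K)%N -> (0 < balanced_num)%N ->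
  \sum_(f in family (has_row_sums N)) fam_pmf f * (fam_bad f)%:R <=
  (\prod_i poisson_pmf M (N i)) *
  ((\sum_(u : signs | walk u == 0) \sum_(v : signs | walk v == 0)
     \prod_i win_corr kap (N i) (overlap R u v)) /
    (balanced_num%:R * \prod_i win_prob R kap (N i)) ^+ 2 - 1).
Proof.
move=> NK b0; set mu := balanced_num%:R * _; set p := \prod_i poisson_pmf M (N i).
have mu0 : 0 < mu.
  rewrite mulr_gt0 ?ltr0n //; apply: prodr_gt0 => i _.
  by have [] := win_prob_gt0_inv_le R (N i) kap_gt0.
have S0 : \sum_(f in family (has_row_sums N)) fam_pmf f = p.
  rewrite (eq_bigr (fun f => fam_pmf f * \prod_(i < m) 1)); last first.
    by move=> f _; rewrite big1 ?mulr1.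
  rewrite (sum_fam_pmf N (fun=> fun=> 1)); apply: eq_bigr => i _.
  rewrite -(@sum_row_pmf R n K lambda) //; apply: eq_bigr => y _; exact: mulr1.
have S1 (u : signs) : walk u == 0 ->
    \sum_(f in family (has_row_sums N)) fam_pmf f * (fam_ok u f)%:R =
    p * \prod_i win_prob R kap (N i).
  move=> /eqP u0; rewrite (eq_bigr (fun f : fam => fam_pmf f *
    \prod_i (row_ok kap u (fnat (f i)))%:R)); last by move=> f _; congr (_ * _); exact: fam_okE.
  rewrite (sum_fam_pmf N (fun=> fun y => (row_ok kap u (fnat y))%:R)) -big_split.
  apply: eq_bigr => i _; apply: (@row_pmf_sum_eq R n K lambda n_gt0 lambda_gt0 (N i) _
    (fun x => (row_ok kap u x)%:R) (NK i)).
  exact: (sum_occ_window R n_gt0).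
have S2 (u v : signs) : walk u == 0 -> walk v == 0 ->
    \sum_(f in family (has_row_sums N)) fam_pmf f * ((fam_ok u f)%:R * (fam_ok v f)%:R) =
    p * \prod_i win_corr kap (N i) (overlap R u v).
  move=> /eqP u0 /eqP v0; rewrite (eq_bigr (fun f : fam => fam_pmf f *
    \prod_i ((row_ok kap u (fnat (f i)))%:R * (row_ok kap v (fnat (f i)))%:R))); last first.
    by move=> f _; rewrite big_split; congr (_ * (_ * _)); exact: fam_okE.
  rewrite (sum_fam_pmf N (fun=> fun y => (row_ok kap u (fnat y))%:R * (row_ok kap v (fnat y))%:R)).
  rewrite -big_split; apply: eq_bigr => i _.
  apply: (@row_pmf_sum_eq R n K lambda n_gt0 lambda_gt0 (N i) _
    (fun x => (row_ok kap u x)%:R * (row_ok kap v x)%:R) (NK i)).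
  exact: (sum_occ_window2 R n_gt0).
apply: (@le_trans _ _ (\sum_(f in family (has_row_sums N)) fam_pmf f * (mu ^- 2 *
   ((\sum_(u : signs | walk u == 0) \sum_(v : signs | walk v == 0)
     (fam_ok u f)%:R * (fam_ok v f)%:R)
   - 2 * mu * (\sum_(u : signs | walk u == 0) (fam_ok u f)%:R) + mu ^+ 2)))).
  by apply: ler_sum => f _; rewrite ler_wpM2l ?fam_pmf_ge0 ?fam_bad_le.
set S := \sum_(u : signs | walk u == 0) \sum_(v : signs | walk v == 0) \prod_i _.
have -> : p * (S / mu ^+ 2 - 1) = mu ^- 2 * (p * S - 2 * mu * (p * mu) + mu ^+ 2 * p).
  by field; rewrite gt_eqF.
under eq_bigr => f _ do rewrite mulrCA.
rewrite -mulr_sumr ler_wpM2l ?invr_ge0 ?sqr_ge0 //.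
under eq_bigr => f _ do rewrite mulrDr mulrBr.
rewrite big_split sumrB /= le_eqVlt; apply/orP; left; apply/eqP; congr (_ - _ + _).
- rewrite /S mulr_sumr; under eq_bigr => f _ do rewrite mulr_sumr.
  rewrite exchange_big /=; apply: eq_bigr => u u0.
  under eq_bigr => f _ do rewrite mulr_sumr.
  by rewrite exchange_big mulr_sumr /=; apply: eq_bigr => v v0; exact: S2.
- under eq_bigr => f _ do rewrite mulrCA mulr_sumr.
  rewrite -mulr_sumr exchange_big /=; congr (_ * _).
  rewrite (eq_bigr _ S1) sumr_const -[_ *+ _]mulr_natl /mu /balanced_num; ring.
- by rewrite -mulr_suml S0 mulrC.
Qed.

End SecondMoment.

(** * Distribution of the overlap of balanced vectors *)

Lemma sum_sqr_le (R : realDomainType) (I : finType) (P : pred I) (x : I -> R) :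
  (forall i, 0 <= x i) -> \sum_(i | P i) x i ^+ 2 <= (\sum_(i | P i) x i) ^+ 2.
Proof.
move=> x0; rewrite [leRHS]expr2 mulr_suml; apply: ler_sum => i Pi; rewrite expr2 ler_wpM2l //.
by rewrite (bigD1 i) //= lerDl sumr_ge0.
Qed.

Section Overlap.
Variables (R : realType) (n h : nat).
Hypothesis n_even : n = h.*2.

Lemma walk_eq0 (u : {ffun 'I_n -> bool}) : (walk u == 0) = (#|[set j | u j]%SET| == h).
Proof.
have -> : u = [ffun j => j \in [set j | u j]%SET] by apply/ffunP => j; rewrite ffunE inE.
rewrite walk_set card_ord (_ : [set j | _]%SET = [set j | u j]%SET); last first.
  by apply/setP => j; rewrite inE ffunE.
move: #|_| => k; rewrite n_even subr_eq0.
by apply/eqP/eqP => [[]|->] //; lia.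
Qed.

Lemma balanced_numE : balanced_num n = 'C(n, h).
Proof.
have D := card_draws 'I_n h; rewrite card_ord in D; rewrite -D /balanced_num -!sum1_card.
rewrite big_mkcond (@sum_ffun_bool nat) [RHS]big_mkcond; apply: eq_bigr => J _.
rewrite !inE walk_eq0; congr (if _ == _ then _ else _).
by apply: eq_card => j; rewrite inE ffunE.
Qed.

(** [V] is determined by its traces on [U] and on the complement, both of size [h]; they have [a]
    and [h - a] elements. *)
Lemma card_balanced_meet (U : {set 'I_n}) (a : nat) : #|U| = h -> (a <= h)%N ->
  (#|[set V : {set 'I_n} | (#|V| == h) && (#|V :&: U| == a)]%SET| <= 'C(h, a) ^ 2)%N.
Proof.
move=> Uh ah; pose A := [set X : {set 'I_n} | (X \subset U) && (#|X| == a)]%SET.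
pose B := [set X : {set 'I_n} | (X \subset ~: U) && (#|X| == h - a)%N]%SET.
have cA : #|A| = 'C(h, a) by rewrite /A cards_draws Uh.
have cB : #|B| = 'C(h, a).
  by rewrite /B cards_draws cardsCs finset.setCK card_ord Uh n_even -addnn addnK bin_sub.
rewrite -mulnn -{1}cA -cB -cardsX.
rewrite -(@card_in_imset _ _ (fun V => (V :&: U, V :\: U))); last first.
  by move=> V W _ _ [VW VW']; rewrite -(setID V U) VW VW' setID.
apply: subset_leq_card; apply/fintype.subsetP => _ /imsetP[V + ->].
rewrite !inE => /andP[/eqP Vh /eqP Va] /=.
rewrite subsetIr Va eqxx /= finset.setDE subsetIr /=.
by rewrite -finset.setDE cardsD Vh Va.
Qed.

Lemma overlapE (u v : {ffun 'I_n -> bool}) : (0 < h)%N -> walk u = 0 -> walk v = 0 ->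
  overlap R u v = ((#|[set j | v j] :&: [set j | u j]|%SET).*2%:R - h%:R) / h%:R.
Proof.
move=> h0 /eqP u0 /eqP v0; rewrite /overlap; move: (u0) (v0); rewrite !walk_eq0.
set U := [set j | u j]%SET; set V := [set j | v j]%SET => /eqP Uh /eqP Vh.
have sw (w : {ffun 'I_n -> bool}) : walk w == 0 -> \sum_j (-1) ^+ w j = 0 :> R.
  by move=> /eqP w0; rewrite -walk_intr w0.
rewrite (eq_bigr (fun j => ((-1) ^+ u j + (-1) ^+ v j - 1) + 4 * (j \in V :&: U)%:R)); last first.
  by move=> j _; rewrite !inE; case: (u j); case: (v j); rewrite /= ?expr0 ?expr1; ring.
rewrite big_split sumrB big_split /= !sw // -mulr_sumr sumr_const card_ord.
have -> : \sum_(j < n) (j \in V :&: U)%:R = #|V :&: U|%:R :> R.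
  by rewrite -sum1_card natr_sum [RHS]big_mkcond; apply: eq_bigr => j _; case: (j \in _).
move: #|_| => k; rewrite n_even -!muln2 !natrM; have hn : h%:R != 0 :> R by rewrite pnatr_eq0 -lt0n.
by field.
Qed.

Lemma sum_overlap (u : {ffun 'I_n -> bool}) (F : R -> R) :
  (0 < h)%N -> (forall x, 0 <= F x) -> walk u = 0 ->
  \sum_(v : {ffun 'I_n -> bool} | walk v == 0) F (overlap R u v) <=
  \sum_(a < h.+1) 'C(h, a)%:R ^+ 2 * F ((a.*2%:R - h%:R) / h%:R).
Proof.
move=> h0 F0 u0; set U := [set j | u j]%SET.
have Uh : #|U| = h by apply/eqP; rewrite -walk_eq0 u0.
rewrite (partition_big (fun v : {ffun 'I_n -> bool} =>
   inord #|[set j | v j] :&: U|%SET : 'I_h.+1) xpredT) //=.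
apply: ler_sum => a _.
have aE (v : {ffun 'I_n -> bool}) : (inord #|[set j | v j] :&: U|%SET == a) = (#|[set j | v j] :&: U|%SET == a).
  by rewrite -val_eqE /= inordK // ltnS -Uh subset_leq_card // subsetIr.
rewrite (eq_bigr (fun=> F ((a.*2%:R - h%:R) / h%:R))); last first.
  by move=> v /andP[/eqP v0]; rewrite aE => /eqP va; rewrite overlapE // -/U va.
rewrite sumr_const -[leLHS]mulr_natl ler_wpM2r // -natrX ler_nat.
have ah : (a <= h)%N by rewrite -ltnS.
apply: leq_trans (card_balanced_meet Uh ah).
rewrite -(card_imset _ (_ : injective (fun v : {ffun 'I_n -> bool} => [set j | v j]%SET))); last first.
  by move=> v w /setP vw; apply/ffunP => j; have := vw j; rewrite !inE.
apply: subset_leq_card; apply/fintype.subsetP => _ /imsetP[v + ->].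
by rewrite unfold_in aE walk_eq0 inE.
Qed.

End Overlap.

Section OverlapSums.
Variable R : realType.

(** [bin_le_central] reduces this to [walk_mean_expR] at the price of a factor 2. The [- 1] stays
    inside the sum so that the factor falls on the small excess only, not on the main term; the
    excess is nonnegative, as the comparison requires. *)
Lemma near_overlap_sum (h : nat) (c : R) : 8 * h%:R < c ->
  \sum_(a < h.+1) 'C(h, a)%:R ^+ 2 * (expR ((a.*2%:R - h%:R) ^+ 2 / c) - 1)
    <= 'C(h.*2, h)%:R * (2 * (expR (h%:R / (c - 8 * h%:R)) - 1)).
Proof.
move=> hc; have c0 : 0 < c by apply: le_lt_trans hc; rewrite mulr_ge0.
pose E a : R := expR ((h%:R - a.*2%:R) ^+ 2 / c) - 1.
have E0 a : 0 <= E a by rewrite subr_ge0 -expR0 ler_expR divr_ge0 ?sqr_ge0 // ltW.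
apply: (@le_trans _ _ (\sum_(a < h.+1) ('C(h.*2, h)%:R * 2 / 2 ^+ h) * ('C(h, a)%:R * E a))).
  apply: ler_sum => a _; rewrite /E -[a.*2%:R - _]opprB sqrrN -/(E a) expr2 -mulrA.
  rewrite ler_wpM2r ?mulr_ge0 // ler_pdivlMr ?exprn_gt0 // -natrX -!natrM ler_nat.
  by rewrite [leqRHS]mulnC bin_le_central.
rewrite -mulr_sumr -!mulrA ler_wpM2l // ler_wpM2l // mulrC ler_pdivrMr ?exprn_gt0 //.
have := walk_mean_expR hc; rewrite mulrBl mul1r [expR _ * _]mulrC => H.
apply: le_trans (lerB H (lexx (2 ^+ h))); rewrite -natrX -sum_bin natr_sum -sumrB.
by apply: ler_sum => a _; rewrite /E mulrBr mulr1 mulr_natl.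
Qed.

(* Chernoff: a far term satisfies [min a (h - a) <= delta * h], so it is at most
   [exp (y * delta * h)] times its weight in [(1 + exp (- y)) ^ h]. *)
Lemma far_overlap_sum (h : nat) (y delta : R) : 0 <= y ->
  \sum_(a < h.+1 | (1 - 2 * delta) * h%:R < `|a.*2%:R - h%:R|) 'C(h, a)%:R ^+ 2
    <= 4 * expR (h.*2%:R * (y * delta + expR (- y))).
Proof.
move=> y0; apply: (le_trans (sum_sqr_le _ _)) => [a|]; first by [].
have -> : 4 * expR (h.*2%:R * (y * delta + expR (- y))) =
    (2 * expR (h%:R * (y * delta + expR (- y)))) ^+ 2.
  by rewrite exprMn -expRM_natl -natrX mulrA -natrM mul2n.
rewrite ler_sqr ?nnegrE ?mulr_ge0 ?expR_ge0 ?sumr_ge0 //.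
pose x := expR (- y).
apply: (@le_trans _ _ (\sum_(a < h.+1) expR (y * delta * h%:R) *
   ((x ^+ a *+ 'C(h, a)) + (x ^+ (h - a) *+ 'C(h, a))))).
  rewrite [leLHS]big_mkcond; apply: ler_sum => a _.
  have ah : (a <= h)%N by rewrite -ltnS.
  case: ifPn => [far|_]; last first.
    by rewrite mulr_ge0 ?expR_ge0 // addr_ge0 ?mulrn_wge0 ?exprn_ge0 ?expR_ge0.
  rewrite -mulrnDl [leRHS]mulrnAr -[leRHS]mulr_natl; apply: ler_peMr => //.
  have key (b : nat) : b%:R <= delta * h%:R -> 1 <= expR (y * delta * h%:R) * x ^+ b.
    move=> bd; rewrite /x -expRM_natl -expRD -[leLHS]expR0 ler_expR.
    have -> : y * delta * h%:R + b%:R * - y = y * (delta * h%:R - b%:R) by ring.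
    by rewrite mulr_ge0 // subr_ge0.
  have x0 (b : nat) : 0 <= expR (y * delta * h%:R) * x ^+ b.
    by rewrite mulr_ge0 ?exprn_ge0 ?expR_ge0.
  rewrite mulrDr; have [h1|h1] : a%:R <= delta * h%:R \/ (h - a)%:R <= delta * h%:R.
  + move: far; rewrite natrB // -muln2 natrM lter_normr => /orP[]; lra.
  + by apply: (le_trans (key _ h1)); rewrite lerDl.
  + by apply: (le_trans (key _ h1)); rewrite lerDr.
rewrite -mulr_sumr big_split /=.
have s1 : \sum_(a < h.+1) x ^+ a *+ 'C(h, a) = (1 + x) ^+ h.
  by rewrite exprDn; apply: eq_bigr => a _; rewrite expr1n mul1r.
have s2 : \sum_(a < h.+1) x ^+ (h - a) *+ 'C(h, a) = (1 + x) ^+ h.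
  by rewrite addrC exprDn; apply: eq_bigr => a _; rewrite expr1n mulr1.
rewrite s1 s2 -mulr2n -[_ *+ 2]mulr_natl mulrCA ler_wpM2l // mulrDr expRD.
rewrite -(mulrC h%:R) ler_wpM2l ?expR_ge0 // expRM_natl.
by apply: lerXn2r; rewrite ?nnegrE ?addr_ge0 ?expR_ge0 // expR_ge1Dx.
Qed.

End OverlapSums.

(** * Relative variance for given row sums *)

Section Excess.
Variables (R : realType) (m n h kap : nat) (delta y : R) (N : 'I_m -> nat).
Hypotheses (n_even : n = h.*2) (h_gt0 : (0 < h)%N) (m_gt0 : (0 < m)%N) (kap_gt0 : (0 < kap)%N).
Hypotheses (delta_gt0 : 0 < delta) (delta_le : delta <= 4^-1) (y_ge0 : 0 <= y).

Let rho0 : R := 1 - 2 * delta.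

(** The coefficient of [rho ^ 2] in [win_corr_le] at the threshold [rho0 = 1 - 2 * delta]. *)
Definition corr_const : R := 16 / Num.sqrt (1 - rho0) / rho0 ^+ 2.

Notation C := corr_const.

Let rho0_gt0 : 0 < rho0. Proof. by have := delta_le; have := delta_gt0; rewrite /rho0; lra. Qed.
Let rho0_lt1 : rho0 < 1. Proof. by have := delta_le; have := delta_gt0; rewrite /rho0; lra. Qed.

Lemma corr_const_gt0 : 0 < C.
Proof.
by rewrite divr_gt0 ?exprn_gt0 ?rho0_gt0 // divr_gt0 // sqrtr_gt0 subr_gt0 rho0_lt1.
Qed.

Let D : R := \prod_i (win_prob R kap (N i))^-1.

Let q_gt0 i : 0 < win_prob R kap (N i).
Proof. by have [] := win_prob_gt0_inv_le R (N i) kap_gt0. Qed.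

Lemma win_corr_ge0 (k : nat) (rho : R) : `|rho| <= 1 -> 0 <= win_corr kap k rho.
Proof.
move=> r1; rewrite divr_ge0 ?exprn_ge0 // sumr_ge0 // => e _; rewrite mulr_ge0 // sumr_ge0 // => e' _.
by rewrite mulr_ge0 // prodr_ge0 // => i _; exact: signed_factor_ge0.
Qed.

(** Near pairs use [win_corr_le] and [1 + x <= exp x]; far pairs use [Q <= q], so that each ratio is
    at most [1 / q]. A single expression covers both, with the leading [1] apart, since it cancels
    in the variance. *)
Lemma prod_corr_ratio_le (rho : R) : `|rho| <= 1 ->
  \prod_i (win_corr kap (N i) rho / win_prob R kap (N i) ^+ 2) <=
  1 + ((expR (C * m%:R * rho ^+ 2) - 1) + D * (rho0 < `|rho|)%R%:R).
Proof.
move=> r1; have r2 : 0 <= C * m%:R * rho ^+ 2.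
  by rewrite mulr_ge0 ?sqr_ge0 // mulr_ge0 // ltW ?corr_const_gt0.
have [near|far] := leP `|rho| rho0.
  rewrite mulr0 addr0 addrC subrK.
  have -> : expR (C * m%:R * rho ^+ 2) = \prod_(i < m) expR (C * rho ^+ 2).
    by rewrite prodr_const card_ord -expRM_natl; congr expR; ring.
  apply: ler_prod => i _; rewrite divr_ge0 ?sqr_ge0 ?win_corr_ge0 //=.
  apply: le_trans (expR_ge1Dx _); rewrite ler_pdivrMr ?exprn_gt0 // mulrC.
  exact: win_corr_le.
rewrite mulr1; apply: (@le_trans _ _ D); last first.
  by rewrite addrA lerDr addrC subrK expR_ge0.
apply: ler_prod => i _; rewrite divr_ge0 ?sqr_ge0 ?win_corr_ge0 //=.
rewrite ler_pdivrMr ?exprn_gt0 // expr2 mulKf ?gt_eqF //.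
exact: win_corr_le_prob.
Qed.

Lemma overlap_le1 (u v : {ffun 'I_n -> bool}) : `|overlap R u v| <= 1.
Proof.
rewrite normrM normfV normr_nat ler_pdivrMr ?mul1r; last first.
  by rewrite ltr0n n_even; lia.
apply: (le_trans (ler_norm_sum _ _ _)); rewrite (eq_bigr (fun=> 1)) ?sumr_const ?card_ord //.
by move=> j _; rewrite normrM !normrX normrN normr1 !expr1n mulr1.
Qed.

Lemma balanced_num_gt0 : (0 < balanced_num n)%N.
Proof. by rewrite (balanced_numE n_even) n_even bin_gt0 -addnn leq_addr. Qed.

(** At overlap [rho = (2a - h) / h] the exponent [C m rho ^ 2] is [(2a - h) ^ 2 / c] with
    [c = h ^ 2 / (C m)]; the hypothesis is the condition [8 h < c] of [near_overlap_sum]. The first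
    term on the right comes from near pairs, the second from far ones. *)
Lemma excess_le : 8 * h%:R < h%:R ^+ 2 / (C * m%:R) ->
  (\sum_(u : {ffun 'I_n -> bool} | walk u == 0) \sum_(v : {ffun 'I_n -> bool} | walk v == 0)
     \prod_i win_corr kap (N i) (overlap R u v)) /
    ((balanced_num n)%:R * \prod_i win_prob R kap (N i)) ^+ 2 - 1 <=
  2 * (expR (h%:R / (h%:R ^+ 2 / (C * m%:R) - 8 * h%:R)) - 1)
  + D / (balanced_num n)%:R * (4 * expR (n%:R * (y * delta + expR (- y)))).
Proof.
move=> hc; set c := h%:R ^+ 2 / _ in hc *.
have C0 := corr_const_gt0; have mR : 0 < m%:R :> R by rewrite ltr0n.
have hR : 0 < h%:R :> R by rewrite ltr0n.
set b : R := (balanced_num n)%:R; have b0 : 0 < b by rewrite ltr0n balanced_num_gt0.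
have bE : b = 'C(h.*2, h)%:R by rewrite /b (balanced_numE n_even) n_even.
set q := \prod_i win_prob R kap (N i).
have q0 : 0 < q by apply: prodr_gt0 => i _; exact: q_gt0.
have D0 : 0 <= D by apply: prodr_ge0 => i _; rewrite invr_ge0 ltW.
pose G (rho : R) := (expR (C * m%:R * rho ^+ 2) - 1) + D * (rho0 < `|rho|)%R%:R.
have G0 rho : 0 <= G rho.
  rewrite addr_ge0 ?mulr_ge0 // subr_ge0 -[leLHS]expR0 ler_expR.
  by rewrite mulr_ge0 ?sqr_ge0 // mulr_ge0 // ltW.
pose X : R := b * (2 * (expR (h%:R / (c - 8 * h%:R)) - 1)) + D * (4 * expR (n%:R * (y * delta + expR (- y)))).
have sumG (u : {ffun 'I_n -> bool}) : walk u = 0 ->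
    \sum_(v : {ffun 'I_n -> bool} | walk v == 0) G (overlap R u v) <= X.
  move=> u0; apply: (le_trans (sum_overlap n_even h_gt0 G0 u0)).
  rewrite (eq_bigr (fun a : 'I_h.+1 =>
     'C(h, a)%:R ^+ 2 * (expR ((a.*2%:R - h%:R) ^+ 2 / c) - 1) +
     D * (if rho0 * h%:R < `|a.*2%:R - h%:R| then 'C(h, a)%:R ^+ 2 else 0))); last first.
    move=> a _; rewrite /G mulrDr; congr (_ * (expR _ - _) + _).
      by rewrite /c; field; rewrite !gt_eqF.
    rewrite mulrCA normrM normfV normr_nat ltr_pdivlMr //.
    by case: ifP => _; rewrite ?mulr1 ?mulr0.
  rewrite big_split -mulr_sumr -big_mkcond /=; apply: lerD.
    by rewrite bE; exact: near_overlap_sum.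
  by rewrite ler_wpM2l // n_even; exact: far_overlap_sum.
have sumr (u : {ffun 'I_n -> bool}) : walk u == 0 ->
    \sum_(v : {ffun 'I_n -> bool} | walk v == 0) \prod_i win_corr kap (N i) (overlap R u v)
    <= q ^+ 2 * (b + X).
  move=> /eqP u0.
  apply: (@le_trans _ _ (\sum_(v : {ffun 'I_n -> bool} | walk v == 0) q ^+ 2 * (1 + G (overlap R u v)))).
    apply: ler_sum => v _; have := prod_corr_ratio_le (overlap_le1 u v).
    rewrite big_split prodfV /= prodrXl -/q -/(G _) ler_pdivrMr ?exprn_gt0 // mulrC.
    by [].
  rewrite -mulr_sumr ler_wpM2l ?sqr_ge0 // big_split /= sumr_const lerD ?sumG //.
rewrite lerBlDl ler_pdivrMr ?exprn_gt0 ?mulr_gt0 //.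
apply: (le_trans (ler_sum _ sumr)); rewrite sumr_const -[leLHS]mulr_natl -/(balanced_num n) -/b.
rewrite le_eqVlt; apply/orP; left; apply/eqP; rewrite /X.
by move: (expR _) (expR _) => ? ?; field; rewrite gt_eqF.
Qed.

End Excess.

(** * Conditional against unconditional first moment *)

Section InverseProduct.
Variables (R : realType) (m kap : nat) (M eps : R) (N : 'I_m -> nat).
Hypotheses (kap_gt0 : (0 < kap)%N) (M_gt0 : 0 < M).

(** Here [p] stands for the bound on the unconditional success probability of a row. The claim is
    that fixing the row sums loses at most [exp(O(m))] as long as their total is [O(m M)]. *)
Lemma prod_inv_win_prob_le (p T : R) : 0 <= p -> p <= 1 -> p <= kap.+1%:R / Num.sqrt M ->
  (\sum_i N i)%:R <= T ->
  p ^+ m * \prod_i (win_prob R kap (N i))^-1 <= expR (5 * m%:R + 4 * T / M).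
Proof.
move=> p0 p1 pk NT.
have k1 : 1 <= kap%:R :> R by rewrite ler1n.
have k0 : 0 < kap%:R :> R by rewrite ltr0n.
have sM : 0 < Num.sqrt M by rewrite sqrtr_gt0.
have e3 : 4 <= expR 3 :> R by apply: le_trans (expR_ge1Dx 3); lra.
(* Both bounds on [p / kap] are needed: [4 / M] multiplies [N i], while [1] takes care of the extra
   unit in [N i + 1]. *)
have pkap : (p / kap%:R) ^+ 2 <= 4 / M.
  have -> : 4 / M = (2 / Num.sqrt M) ^+ 2.
    by rewrite expr_div_n sqr_sqrtr ?(ltW M_gt0) // -natrX.
  rewrite ler_sqr ?nnegrE ?divr_ge0 ?(ltW k0) ?(ltW sM) // ler_pdivrMr //.
  apply: (le_trans pk); rewrite mulrAC ler_wpM2r ?invr_ge0 ?(ltW sM) // -natr1; lra.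
have pkap1 : (p / kap%:R) ^+ 2 <= 1.
  rewrite -[leRHS](expr1n _ 2) ler_sqr ?nnegrE ?divr_ge0 ?(ltW k0) // ler_pdivrMr // mul1r.
  exact: le_trans k1.
have term i : p * (win_prob R kap (N i))^-1 <= expR (5 + 4 / M * (N i)%:R).
  have [q0 qi] := win_prob_gt0_inv_le R (N i) kap_gt0.
  apply: (le_trans (ler_wpM2l p0 qi)).
  set s := Num.sqrt (N i).+1%:R; have s0 : 0 <= s by rewrite sqrtr_ge0.
  pose z := p / kap%:R * s; have z0 : 0 <= z by rewrite mulr_ge0 // divr_ge0 // ltW.
  have zz : z <= 1 + z ^+ 2.
    by rewrite -subr_ge0; have := sqr_ge0 (z - 2^-1); rewrite /= => H; nra.
  have z2 : z ^+ 2 <= 1 + 4 / M * (N i)%:R.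
    rewrite exprMn sqr_sqrtr // -natr1 mulrDr mulr1 addrC lerD //.
    by rewrite ler_wpM2r.
  apply: (@le_trans _ _ (4 * expR (2 + 4 / M * (N i)%:R))).
    rewrite mulrCA ler_wpM2l //; apply: (@le_trans _ _ (1 + z)).
      by rewrite mulrDr mulr1 /z mulrCA mulrA [s * _]mulrC; lra.
    by apply: (le_trans (expR_ge1Dx z)); rewrite ler_expR; lra.
  (* The [5] is [3] from [4 <= exp 3] plus [2] from [z <= 1 + z ^ 2 <= 2 + 4 N / M]. *)
  have -> : 5 + 4 / M * (N i)%:R = 3 + (2 + 4 / M * (N i)%:R) by ring.
  by rewrite [leRHS]expRD ler_wpM2r ?expR_ge0.
have -> : p ^+ m = \prod_(i < m) p by rewrite prodr_const card_ord.
rewrite -big_split /=; apply: (@le_trans _ _ (\prod_(i < m) expR (5 + 4 / M * (N i)%:R))).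
  apply: ler_prod => i _; rewrite term andbT mulr_ge0 // invr_ge0 win_prob_ge0 //.
rewrite -expR_sum ler_expR big_split /= sumr_const card_ord -[_ *+ m]mulr_natr lerD2l.
by rewrite -mulr_sumr -natr_sum [leRHS]mulrAC ler_wpM2l // divr_ge0 // ltW.
Qed.

End InverseProduct.

(** * Removing the conditioning on the row sums *)

Section Truncation.
Variables (R : realType) (m n K kap : nat) (lambda T eta : R).
Hypotheses (n_gt0 : (0 < n)%N) (lambda_gt0 : 0 < lambda).
Hypotheses (T_gt0 : 0 < T) (T_lt : T < K.+1%:R) (eta_ge0 : 0 <= eta).

Notation fam := {ffun 'I_m -> {ffun 'I_n -> 'I_K.+1}}.

Let M : R := n%:R * lambda.

Lemma sum_fam_prod (G : 'I_m -> {ffun 'I_n -> 'I_K.+1} -> R) :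
  \sum_(f : fam) fam_pmf lambda f * (\prod_i G i (f i)) =
  \prod_i \sum_y row_pmf lambda y * G i y.
Proof.
rewrite (bigA_distr_bigA (fun i y => row_pmf lambda y * G i y)).
by apply: eq_bigr => f _; rewrite big_split.
Qed.

Lemma sum_fam_mean :
  \sum_(f : fam) fam_pmf lambda f * (\sum_i row_sum (f i))%:R <= m%:R * M.
Proof.
under eq_bigr => f _ do rewrite natr_sum mulr_sumr.
rewrite exchange_big /=.
apply: (@le_trans _ _ (\sum_(i < m) M)); last by rewrite sumr_const card_ord mulr_natl.
apply: ler_sum => i _.
pose G k (y : {ffun 'I_n -> 'I_K.+1}) : R := if k == i then (row_sum y)%:R else 1.
rewrite (eq_bigr (fun f : fam => fam_pmf lambda f * \prod_k G k (f k))); last first.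
  move=> f _; congr (_ * _); rewrite (bigD1 i) //= {1}/G eqxx big1 ?mulr1 // => k /negbTE ki.
  by rewrite /G ki.
rewrite sum_fam_prod (bigD1 i) //= -[leRHS]mulr1.
have S0 k : 0 <= \sum_y row_pmf lambda y * G k y.
  by apply: sumr_ge0 => y _; rewrite mulr_ge0 ?row_pmf_ge0 // /G; case: ifP.
apply: ler_pM => //; first by apply: prodr_ge0.
  rewrite (eq_bigr (fun y => row_pmf lambda y * (row_sum y)%:R)).
    exact: sum_row_pmf_mean.
  by move=> y _; rewrite /G eqxx.
apply: prodr_ile1 => k /negbTE ki; rewrite S0 /=.
rewrite (eq_bigr (fun y => row_pmf lambda y)); first exact: sum_row_pmf_le1.
by move=> y _; rewrite /G ki mulr1.
Qed.

(** Markov's inequality discards the families of total above [T], whose mean is at most [m M]. For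
    the others [T < K + 1] keeps every row sum below the truncation level, where the conditional
    bound applies. *)
Lemma sum_fam_bad_le :
  (forall N : 'I_m -> nat, (forall i, N i < K.+1)%N -> (\sum_i N i)%:R <= T ->
    \sum_(f in family (@has_row_sums m n K.+1 N)) fam_pmf lambda f * (fam_bad kap f)%:R
      <= (\prod_i poisson_pmf M (N i)) * eta) ->
  \sum_(f : fam) fam_pmf lambda f * (fam_bad kap f)%:R <= m%:R * M / T + eta.
Proof.
move=> H; rewrite (bigID (fun f : fam => T < (\sum_i row_sum (f i))%:R)) /=; apply: lerD.
  apply: (@le_trans _ _ ((\sum_(f : fam) fam_pmf lambda f * (\sum_i row_sum (f i))%:R) / T)); last first.
    by rewrite ler_pM2r ?invr_gt0 // sum_fam_mean.
  rewrite mulr_suml [leLHS]big_mkcond; apply: ler_sum => f _; case: ifP => [fT|_]; last first.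
    by rewrite divr_ge0 ?mulr_ge0 ?fam_pmf_ge0 // ltW.
  rewrite -mulrA ler_wpM2l ?fam_pmf_ge0 // ler_pdivlMr //.
  by case: (fam_bad _ _); rewrite ?mul1r ?mul0r // ltW.
pose p (f : fam) : {ffun 'I_m -> 'I_K.+1} := [ffun i => inord (row_sum (f i))].
have pE (f : fam) i : (\sum_i row_sum (f i))%:R <= T -> p f i = row_sum (f i) :> nat.
  move=> fT; rewrite ffunE inordK // -(ltr_nat R); apply: le_lt_trans T_lt.
  by apply: le_trans fT; rewrite ler_nat (bigD1 i) //= leq_addr.
rewrite (partition_big p (fun N : {ffun 'I_m -> 'I_K.+1} => (\sum_i N i)%:R <= T)) /=; last first.
  move=> f; rewrite -leNgt => fT; rewrite (eq_bigr (fun i => row_sum (f i))) // => i _.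
  exact: pE.
apply: (@le_trans _ _ (\sum_(N : {ffun 'I_m -> 'I_K.+1} | (\sum_i N i)%:R <= T)
    (\prod_i poisson_pmf M (N i)) * eta)).
  apply: ler_sum => N NT; apply: le_trans (H (fun i => N i) (fun i => ltn_ord (N i)) NT).
  rewrite big_mkcond [leRHS]big_mkcond; apply: ler_sum => f _.
  case: ifP => [/andP[+ /eqP fN]|_]; last first.
    by case: ifP => _ //; rewrite mulr_ge0 ?fam_pmf_ge0.
  rewrite -leNgt => fT; rewrite ifT //; apply/familyP => i.
  by rewrite inE -fN pE.
rewrite -mulr_suml -[leRHS]mul1r ler_wpM2r //.
apply: (@le_trans _ _ (\sum_(N : {ffun 'I_m -> 'I_K.+1}) \prod_i poisson_pmf M (N i))).
  rewrite [leLHS]big_mkcond; apply: ler_sum => N _; case: ifP => // _.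
  by apply: prodr_ge0 => i _; exact: poisson_pmf_ge0.
rewrite -(bigA_distr_bigA (fun i (k : 'I_K.+1) => poisson_pmf M k)).
apply: prodr_ile1 => i _; rewrite sum_poisson_le1 ?row_mean_gt0 // andbT.
by apply: sumr_ge0 => k _; exact: poisson_pmf_ge0.
Qed.

End Truncation.

(** * Choice of the constants *)

(** The budget is [eps / 2] for an atypical total of the row sums, [eps / 4] for near pairs and
    [eps / 4] for far pairs. The exponential hypothesis is the form in which the lower bound on the
    expected count enters. *)
Lemma bad_family_small (R : realType) (c eps : R) : 0 < c -> 0 < eps -> eps <= 1 ->
  exists eta n0 : R, 0 < eta /\ forall (m n h kap : nat) (lambda : R),
    n = h.*2 -> (0 < m)%N -> (0 < h)%N -> (0 < kap)%N -> 0 < lambda ->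
    n0 <= n%:R -> m%:R <= eta * n%:R ->
    expR (c * n%:R) <= (balanced_num n)%:R *
      Num.min 1 (kap.+1%:R / Num.sqrt (n%:R * lambda)) ^+ m ->
    exists K0, forall K, (K0 <= K)%N ->
      \sum_(f : {ffun 'I_m -> {ffun 'I_n -> 'I_K.+1}}) fam_pmf lambda f * (fam_bad kap f)%:R <= eps.
Proof.
(* The growth rate of far pairs is [y * delta + exp (- y)]. Since [exp (- y) <= 1 / y], these values
   make both terms at most [c / 8]. *)
move=> c0 e0 e1; pose y : R := 8 / c; have y0 : 0 < y by rewrite divr_gt0.
pose delta : R := Num.min 4^-1 (c ^+ 2 / 64).
have d0 : 0 < delta by rewrite lt_min invr_gt0 ltr0n divr_gt0 ?exprn_gt0.
have d1 : delta <= 4^-1 by rewrite ge_min lexx.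
have yd : y * delta + expR (- y) <= c / 4.
  have h1 : y * delta <= c / 8.
    apply: (@le_trans _ _ (y * (c ^+ 2 / 64))); first by rewrite ler_wpM2l ?(ltW y0) // ge_min lexx orbT.
    by rewrite /y le_eqVlt; apply/orP; left; apply/eqP; field; rewrite gt_eqF.
  have h2 : expR (- y) <= c / 8.
    rewrite expRN -[leRHS]invrK lef_pV2 ?posrE ?expR_gt0 ?invr_gt0 ?divr_gt0 // invf_div -/y.
    by apply: le_trans (expR_ge1Dx y); rewrite lerDr.
  lra.
pose C : R := corr_const delta; have C0 : 0 < C := corr_const_gt0 d0 d1.
(* [C2 * m] is the loss [5 m + 4 T / M] for the threshold [T = 2 m M / eps], which gives Markov's
   bound [eps / 2]. *)
pose C2 : R := 5 + 8 / eps; have C20 : 0 < C2 by rewrite addr_gt0 // divr_gt0.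
pose th : R := eps / 16; have th0 : 0 < th by rewrite divr_gt0.
(* The first bound on [m / n] keeps the loss [C2 * m] below [c n / 4]; the second makes the near
   exponent at most [th]. The value of [n0] ensures [4 exp(- c n / 2) <= eps / 4], which is what
   remains of the far term: [c / 4] for the loss and [c / 4] for the far pairs, against [c]. *)
exists (Num.min (c / (4 * C2)) (2 * C * (8 + th^-1))^-1), (32 / (c * eps)).
have CC : 0 < 2 * C * (8 + th^-1).
  by rewrite mulr_gt0 ?addr_gt0 ?invr_gt0 // mulr_gt0.
split; first by rewrite lt_min divr_gt0 ?mulr_gt0 //= invr_gt0.
move=> m n h kap lambda nh m0 h0 k0 l0 n0 mn hyp.
have mR : 0 < m%:R :> R by rewrite ltr0n.
have hR : 0 < h%:R :> R by rewrite ltr0n.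
have nR : n%:R = 2 * h%:R :> R by rewrite nh -muln2 natrM mulrC.
have np : (0 < n)%N by rewrite nh double_gt0.
have nR0 : 0 < n%:R :> R by rewrite ltr0n.
pose M : R := n%:R * lambda; have M0 : 0 < M by rewrite mulr_gt0.
pose T : R := 2 * (m%:R * M) / eps; have T0 : 0 < T by rewrite divr_gt0 // mulr_gt0 // mulr_gt0.
have mC2 : C2 * m%:R <= c / 4 * n%:R.
  apply: (@le_trans _ _ (C2 * (c / (4 * C2) * n%:R))).
    rewrite ler_wpM2l ?(ltW C20) //; apply: (le_trans mn); rewrite ler_wpM2r ?ler0n //.
    by rewrite ge_min lexx.
  by rewrite le_eqVlt; apply/orP; left; apply/eqP; field; rewrite gt_eqF.
have mC : (8 + th^-1) * (C * m%:R) <= h%:R.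
  have H : m%:R <= n%:R / (2 * C * (8 + th^-1)).
    rewrite mulrC; apply: (le_trans mn); rewrite ler_wpM2r ?ler0n //.
    by rewrite ge_min lexx orbT.
  move: H; rewrite ler_pdivlMr // nR => H; rewrite -(ler_pM2l (_ : 0 < 2 :> R)) //.
  by apply: le_trans H; rewrite le_eqVlt; apply/orP; left; apply/eqP; ring.
have Cm0 : 0 < C * m%:R by rewrite mulr_gt0.
have hc : 8 * h%:R + th^-1 * h%:R <= h%:R ^+ 2 / (C * m%:R).
  rewrite ler_pdivlMr // -mulrDl mulrAC expr2.
  by apply: (ler_wpM2r (ltW hR)); exact: mC.
have hc' : 8 * h%:R < h%:R ^+ 2 / (C * m%:R).
  by apply: lt_le_trans hc; rewrite ltrDl mulr_gt0 // invr_gt0.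
set p := Num.min 1 _ in hyp.
have p0 : 0 <= p by rewrite le_min ler01 divr_ge0 ?sqrtr_ge0.
have p1 : p <= 1 by rewrite ge_min lexx.
have pk : p <= kap.+1%:R / Num.sqrt M by rewrite ge_min lexx orbT.
exists (Num.truncn T).+1 => K K0.
have TK : T < K.+1%:R.
  by apply: lt_le_trans (truncnS_gt T) _; rewrite ler_nat; apply: leq_trans K0 _.
have -> : eps = m%:R * M / T + eps / 2.
  by rewrite /T; field; rewrite !gt_eqF.
have e20 : 0 <= eps / 2 by rewrite divr_ge0 // ltW.
apply: (sum_fam_bad_le np l0 T0 TK e20) => N NK NT.
have bp := balanced_num_gt0 nh.
apply: (le_trans (second_moment np l0 k0 NK bp)).
rewrite ler_wpM2l //; first by apply: prodr_ge0 => i _; exact: poisson_pmf_ge0.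
apply: (le_trans (excess_le N nh h0 m0 k0 d0 d1 (ltW y0) hc')).
have partA : 2 * (expR (h%:R / (h%:R ^+ 2 / (C * m%:R) - 8 * h%:R)) - 1) <= eps / 4.
  have ht : h%:R / (h%:R ^+ 2 / (C * m%:R) - 8 * h%:R) <= th.
    rewrite ler_pdivrMr ?subr_gt0 // -ler_pdivrMl //; lra.
  have : expR (h%:R / (h%:R ^+ 2 / (C * m%:R) - 8 * h%:R)) <= 1 + 2 * th.
    apply: (@le_trans _ _ (expR th)); first by rewrite ler_expR.
    have t1 : th <= 2^-1 by rewrite /th; lra.
    have t2 : 0 < 1 - th by lra.
    apply: (@le_trans _ _ (1 - th)^-1).
      rewrite -[expR th]invrK lef_pV2 ?posrE ?invr_gt0 ?expR_gt0 // -expRN.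
      exact: expR_ge1Dx.
    rewrite -div1r ler_pdivrMr //; nra.
  rewrite /th; lra.
have partB : (\prod_i (win_prob R kap (N i))^-1) / (balanced_num n)%:R *
    (4 * expR (n%:R * (y * delta + expR (- y)))) <= eps / 4.
  have b0 : 0 < (balanced_num n)%:R :> R by rewrite ltr0n.
  have pm0 : 0 < p ^+ m.
    rewrite lt_neqAle exprn_ge0 // andbT; apply/eqP => E; move: hyp; rewrite -E mulr0.
    by rewrite leNgt expR_gt0.
  have h1 : \prod_i (win_prob R kap (N i))^-1 / (balanced_num n)%:R <= expR (- (3 / 4 * c * n%:R)).
    rewrite ler_pdivrMr // -(ler_pM2l pm0).
    apply: (le_trans (prod_inv_win_prob_le k0 M0 p0 p1 pk NT)).
    apply: (@le_trans _ _ (expR (- (3 / 4 * c * n%:R)) * expR (c * n%:R))); last first.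
      rewrite [leRHS]mulrCA ler_wpM2l ?expR_ge0 // [leRHS]mulrC; exact: hyp.
    rewrite -expRD ler_expR.
    have -> : 5 * m%:R + 4 * T / M = C2 * m%:R.
      by rewrite /T /C2; field; rewrite !gt_eqF.
    lra.
  apply: (@le_trans _ _ (expR (- (3 / 4 * c * n%:R)) * (4 * expR (n%:R * (c / 4))))).
    apply: ler_pM => //.
    - rewrite divr_ge0 ?ler0n // prodr_ge0 // => i _; rewrite invr_ge0 win_prob_ge0 //.
    - by rewrite ler_wpM2l // ler_expR ler_wpM2l.
  rewrite mulrCA -expRD.
  have -> : - (3 / 4 * c * n%:R) + n%:R * (c / 4) = - (c * n%:R / 2) by field.
  rewrite expRN ler_pdivrMr ?expR_gt0 //.
  apply: (@le_trans _ _ (eps / 4 * (1 + c * n%:R / 2))); last first.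
    by rewrite ler_wpM2l ?expR_ge1Dx // divr_ge0 // ltW.
  move: n0; rewrite ler_pdivrMr ?mulr_gt0 // => n0; nra.
by rewrite -/C; apply: (le_trans (lerD partA partB)); lra.
Qed.

(** * From truncated finite sums to probabilities *)

Section PoissonLaw.
Variables (d : measure_display) (T : measurableType d) (R : realType) (P : probability T R).
Variables (m n : nat) (lambda : R) (A : T -> 'M[nat]_(m, n)).
Hypothesis A_poisson : poisson_ensemble P lambda A.

Definition fam_mx (K : nat) (f : {ffun 'I_m -> {ffun 'I_n -> 'I_K}}) : 'M[nat]_(m, n) :=
  \matrix_(i, j) (f i j : nat).

Lemma measurable_entry (i : 'I_m) (j : 'I_n) (B : set nat) : measurable [set w | B (A w i j)].
Proof.
have [mA _ _] := A_poisson; have := mA i j measurableT B I.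
by rewrite setTI.
Qed.

Lemma eq_mxE (M : 'M[nat]_(m, n)) : [set w | A w = M] =
  \bigcap_(ij in [set` [set: 'I_m * 'I_n]%SET]) (fun w => A w ij.1 ij.2) @^-1` [set M ij.1 ij.2].
Proof.
apply/seteqP; split => [w /= AM ij _|w /= H]; first by rewrite /preimage /= AM.
by apply/matrixP => i j; have := H (i, j); apply; rewrite /= inE.
Qed.

Lemma measurable_eq_mx (M : 'M[nat]_(m, n)) : measurable [set w | A w = M].
Proof.
rewrite eq_mxE; apply: fin_bigcap_measurable => [|ij _]; first exact: finite_finset.
exact: (measurable_entry ij.1 ij.2 [set M ij.1 ij.2]).
Qed.

Lemma prob_fam_mx (K : nat) (f : {ffun 'I_m -> {ffun 'I_n -> 'I_K}}) :
  P [set w | A w = fam_mx f] = (fam_pmf lambda f)%:E.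
Proof.
have [_ pA iA] := A_poisson.
rewrite eq_mxE (iA [set: 'I_m * 'I_n]%SET (fun ij => [set fam_mx f ij.1 ij.2])) //.
rewrite (eq_bigr (fun ij => (poisson_pmf lambda (f ij.1 ij.2))%:E)); last first.
  by move=> [i j] _ /=; have := pA i j (fam_mx f i j); rewrite mxE => <-.
rewrite prodEFin /fam_pmf /row_pmf pair_big /=; congr (_%:E).
by apply: eq_bigl => ij; rewrite inE.
Qed.

Variable S : pred 'M[nat]_(m, n).

Let U (K : nat) : set T := \big[setU/set0]_(f : {ffun 'I_m -> {ffun 'I_n -> 'I_K.+1}})
  (if S (fam_mx f) then [set w | A w = fam_mx f] else set0).

Let in_U K w : U K w <-> S (A w) /\ forall i j, (A w i j < K.+1)%N.
Proof.
split.
  rewrite /U; elim/big_ind: _ => [//|B C HB HC [/HB|/HC]//|f _].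
  by case: ifP => // Sf /= ->; split => // i j; rewrite mxE.
move=> [Sw wK]; pose f : {ffun 'I_m -> {ffun 'I_n -> 'I_K.+1}} :=
  [ffun i => [ffun j => Ordinal (wK i j)]].
have fE : fam_mx f = A w by apply/matrixP => i j; rewrite mxE !ffunE.
by rewrite /U (bigD1 f) //= fE Sw; left.
Qed.

Let measurable_U K : measurable (U K).
Proof. by rewrite /U; apply: bigsetU_measurable => f _; case: ifP => // _; exact: measurable_eq_mx. Qed.

Let eventE : [set w | S (A w)] = \bigcup_K U K.
Proof.
apply/seteqP; split => [w /= Sw|w [K _ /in_U[]]//].
exists (\max_i \max_j A w i j)%N => //; apply/in_U; split => // i j.
by rewrite ltnS (bigD1 i) //= leq_max (bigD1 j) //= leq_max leqnn.
Qed.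

Lemma measurable_mx_event : measurable [set w | S (A w)].
Proof. by rewrite eventE; apply: bigcup_measurable => K _. Qed.

(** The event is the increasing union of the [U K], so continuity from below applies. Each [U K] is
    a finite union of single-matrix events, and a union bound suffices for an upper estimate. *)
Lemma prob_mx_event_le (c : R) (K0 : nat) :
  (forall K, (K0 <= K)%N -> \sum_(f : {ffun 'I_m -> {ffun 'I_n -> 'I_K.+1}})
     fam_pmf lambda f * (S (fam_mx f))%:R <= c) ->
  (P [set w | S (A w)] <= c%:E)%E.
Proof.
move=> H; rewrite eventE.
apply: (@cvge_le nat \oo _ R (P \o U)); last first.
  apply: nondecreasing_cvg_mu => //; first by rewrite -eventE; exact: measurable_mx_event.
  move=> K L KL; apply/subsetPset => w /in_U[Sw wK]; apply/in_U; split => // i j.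
  exact: leq_trans (wK i j) _.
exists K0 => // K K0K /=; apply: (@le_trans _ _ (\sum_(f : {ffun 'I_m -> {ffun 'I_n -> 'I_K.+1}})
     fam_pmf lambda f * (S (fam_mx f))%:R)%:E); last by rewrite lee_fin; exact: H.
rewrite -sumEFin.
suff [] : measurable (U K) /\ (P (U K) <= \sum_(f : {ffun 'I_m -> {ffun 'I_n -> 'I_K.+1}})
    (fam_pmf lambda f * (S (fam_mx f))%:R)%:E)%E by [].
rewrite /U; elim/big_ind2: _ => [|B b C c' [mB Bb] [mC Cc]|f _].
- by split => //; rewrite measure0.
- split; first exact: measurableU.
  by apply: (le_trans (measureU2 _ _ _)) => //; exact: leeD.
case: ifP => Sf; rewrite ?mulr1 ?mulr0; last by split => //; rewrite measure0.
by split; [exact: measurable_eq_mx | rewrite prob_fam_mx].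
Qed.

End PoissonLaw.

(** * Translation to matrices, norms and discrepancy *)

Section MatrixSigns.
Variables (R : realType) (m n : nat).

Lemma balancedE (s : {ffun 'I_n -> bool}) : balanced R s = (walk s == 0).
Proof.
rewrite /balanced -(intr_eq0 R) walk_intr; congr (_ == _).
by apply: eq_bigr => j _; rewrite mxE.
Qed.

Definition mx_row (M : 'M[nat]_(m, n)) (i : 'I_m) : {ffun 'I_n -> nat} := [ffun j => M i j].

Lemma natmx_mulE (M : 'M[nat]_(m, n)) (s : {ffun 'I_n -> bool}) (i : 'I_m) :
  (natmx R M *m sign_vec R s) i 0 = (rowdot s (mx_row M i))%:~R.
Proof.
rewrite mxE /rowdot rmorph_sum /=; apply: eq_bigr => j _.
by rewrite !mxE ffunE rmorphM /= rmorphXn /= rmorphN.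
Qed.

Lemma col_norm_leP (v : 'cV[R]_m) (x : R) : 0 <= x ->
  reflect (forall i, `|v i 0| <= x) (`|v| <= x).
Proof.
move=> x0; rewrite [`|v|]mx_normrE; apply: (iffP (bigmax_leP _ _ _ _)) => [[_ H] i|H].
  exact: (H (i, 0)).
by split => // -[i j] _ /=; rewrite (ord1 j).
Qed.

(** The entries of the product are integers, so a real bound [r] may be replaced by its integer
    part. *)
Lemma natmx_norm_le (r : R) (M : 'M[nat]_(m, n)) (s : {ffun 'I_n -> bool}) : 0 <= r ->
  (`|natmx R M *m sign_vec R s| <= r) = [forall i, row_ok (Num.truncn r) s (mx_row M i)].
Proof.
move=> r0; have E i : (`|(natmx R M *m sign_vec R s) i 0| <= r) = row_ok (Num.truncn r) s (mx_row M i).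
  rewrite natmx_mulE -intr_norm /row_ok; case: `|_| (normr_ge0 (rowdot s (mx_row M i))) => // k _.
  by rewrite lez_nat truncn_ge_nat.
apply/col_norm_leP/forallP => // H i; first by rewrite -E.
by rewrite E.
Qed.

Lemma disc_le (M : 'M[nat]_(m, n)) (s : {ffun 'I_n -> bool}) (x : R) :
  `|natmx R M *m sign_vec R s| <= x -> disc (natmx R M) <= x.
Proof. by move=> H; rewrite /disc; exact: (@bigmin_inf _ _ _ _ s). Qed.

(** The source of the [+ 1] in the theorem: the enlarged window [Num.truncn r + 1] is exactly the
    integer part of [r + 1]. *)
Lemma disc_le_fam (K : nat) (r : R) (f : {ffun 'I_m -> {ffun 'I_n -> 'I_K}}) : 0 <= r ->
  ~~ fam_bad (Num.truncn r).+1 f -> disc (natmx R (fam_mx f)) <= r + 1.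
Proof.
move=> r0; rewrite negb_forall => /existsP[s]; rewrite negb_imply negbK => /andP[_ /forallP H].
have rE : (Num.truncn r).+1 = Num.truncn (r + 1).
  apply/esym/truncn_def; have /andP[h1 h2] := truncn_itv r0.
  by rewrite -[in X in X <= _]natr1 -[_.+2%:R]natr1 lerD2r ltrD2r h1.
apply: (disc_le (s := s)); rewrite natmx_norm_le ?addr_ge0 // -rE; apply/forallP => i.
rewrite (_ : mx_row _ _ = fnat (f i)); first exact: H.
by apply/ffunP => j; rewrite !ffunE mxE.
Qed.

End MatrixSigns.

(** * Upper bound on the expected number of solutions *)

Section FirstMoment.
Variables (d : measure_display) (T : measurableType d) (R : realType) (P : probability T R).
Variables (m n : nat) (lambda : R) (A : T -> 'M[nat]_(m, n)).
Hypotheses (n_gt0 : (0 < n)%N) (lambda_gt0 : 0 < lambda) (A_poisson : poisson_ensemble P lambda A).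

Lemma prob_ok_le (r : R) (s : {ffun 'I_n -> bool}) : 0 <= r -> walk s = 0 ->
  (P [set w | (`|natmx R (A w) *m sign_vec R s| <= r)%R] <=
   (Num.min 1 ((Num.truncn r).+1%:R / Num.sqrt (n%:R * lambda)) ^+ m)%R%:E)%E.
Proof.
move=> r0 s0; set p := Num.min 1 _.
apply: (@prob_mx_event_le _ _ _ _ _ _ _ _ A_poisson (fun M => `|natmx R M *m sign_vec R s| <= r) _ 0).
move=> K _; rewrite (eq_bigr (fun f : {ffun 'I_m -> {ffun 'I_n -> 'I_K.+1}} =>
   fam_pmf lambda f * \prod_i (row_ok (Num.truncn r) s (fnat (f i)))%:R)); last first.
  move=> f _; rewrite natmx_norm_le //; congr (_ * _).
  rewrite -fam_okE; congr (nat_of_bool _)%:R; apply: eq_forallb => i.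
  by congr (row_ok _ _ _); apply/ffunP => j; rewrite !ffunE mxE.
rewrite (sum_fam_prod lambda (fun=> fun y => (row_ok (Num.truncn r) s (fnat y))%:R)).
rewrite (_ : p ^+ m = \prod_(i < m) p); last by rewrite prodr_const card_ord.
apply: ler_prod => i _; rewrite sum_row_ok_le // andbT.
by apply: sumr_ge0 => y _; rewrite mulr_ge0 ?row_pmf_ge0.
Qed.

(** Linearity of expectation over balanced vectors. Combined with the assumed lower bound on the
    expectation, it shows that the right-hand side is exponentially large, as [bad_family_small]
    requires. *)
Lemma expectation_balanced_count_le (r : R) : 0 <= r ->
  ('E_P[fun w => (balanced_count r (natmx R (A w)))%:R%R] <=
   ((balanced_num n)%:R * Num.min 1 ((Num.truncn r).+1%:R / Num.sqrt (n%:R * lambda)) ^+ m)%R%:E)%E.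
Proof.
move=> r0; pose E s := [set w | `|natmx R (A w) *m sign_vec R s| <= r].
have mE s : measurable (E s).
  exact: (measurable_mx_event A_poisson (fun M => `|natmx R M *m sign_vec R s| <= r)).
rewrite unlock.
rewrite (eq_integral (fun w => (\sum_(s <- [seq s : {ffun 'I_n -> bool} <- index_enum _ | (walk s == 0)%R])
    (\1_(E s) w)%:E)%E)); last first.
  move=> w _; rewrite sumEFin big_filter /balanced_count -sum1_card natr_sum; congr (_%:E).
  rewrite big_mkcond [RHS]big_mkcond /=; apply: eq_bigr => s _.
  rewrite inE balancedE; case: (walk s == 0) => //=; rewrite indicE.
  rewrite (_ : (w \in E s) = (`|natmx R (A w) *m sign_vec R s| <= r)).
    by move: (`|natmx R (A w) *m sign_vec R s| <= r) => b; case: b.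
  by apply/idP/idP => [/set_mem//|H]; exact: mem_set.
rewrite ge0_integral_sum //; last first.
  by move=> s; apply/measurable_realfun.measurable_EFinP; exact: measurable_realfun.measurable_indic.
rewrite big_filter (eq_bigr (fun s => P (E s))); last first.
  by move=> s _; rewrite integral_indic // setIT.
set p := Num.min 1 _.
apply: (@le_trans _ _ (\sum_(s : {ffun 'I_n -> bool} | (walk s == 0)%R) (p ^+ m)%R%:E)%E).
  by apply: lee_sum => s /eqP s0; exact: prob_ok_le.
rewrite sumEFin sumr_const lee_fin mulr_natl; exact: lexx.
Qed.

End FirstMoment.

(** * Conclusion *)

(** The lower bound excludes [X <= 0], where [lne] is [-oo], and the upper bound excludes [+oo];
    only the real logarithm is left. *)
Lemma expR_le_of_lne (R : realType) (x b : R) (X : \bar R) :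
  (x%:E <= lne X)%E -> (X <= b%:E)%E -> expR x <= b.
Proof.
case: X => [y| |] //=; case: ifPn => // /negbTE y0; rewrite !lee_fin => xy yb.
have y1 : 0 < y by rewrite ltNge y0.
by apply: le_trans yb; rewrite -[leRHS]lnK // ler_expR.
Qed.

Theorem theorem2 (R : realType) (n : nat -> nat) (lambda r : nat -> R)
    (d : nat -> measure_display) (T : forall m, measurableType (d m))
    (P : forall m, probability (T m) R)
    (A : forall m, T m -> 'M[nat]_(m, n m))
    (n_even : forall m, ~~ odd (n m))
    (lambda_gt0 : forall m, 0 < lambda (n m))
    (r_ge0 : forall m, 0 <= r (n m))
    (A_poisson : forall m, poisson_ensemble (P m) (lambda (n m)) (@A m))
    (m_littleo_n : (fun m : nat => m%:R : R) =o_\oo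
                   (fun m : nat => (n m)%:R : R))
    (log_EZ_Theta : exists c c' : R, [/\ 0 < c, c <= c' &
      \forall m \near \oo,
        ((c * (n m)%:R)%:E <=
           lne 'E_(P m)[fun w =>
             (balanced_count (r (n m)) (natmx R (A m w)))%:R]
         <= (c' * (n m)%:R)%:E)%E]) :
  P m [set w | disc (natmx R (A m w)) <= r (n m) + 1] @[m --> \oo] --> 1%E.
Proof.
have [c [c' [c0 _ EZ]]] := log_EZ_Theta.
have n_dom (e : R) : 0 < e -> \forall m \near \oo, m%:R <= e * (n m)%:R.
  move=> e0; move/eqoP: m_littleo_n => /(_ e e0); apply: filterS => m.
  by rewrite !normr_nat.
(* Probabilities are at most one, so eventual lower bounds [1 - eps] for small [eps] give the
   limit. *)
suff main (eps : R) : 0 < eps -> eps <= 1 -> \forall m \near \oo,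
    ((1 - eps)%:E <= P m [set w | (disc (natmx R (A m w)) <= r (n m) + 1)%R])%E.
  pose G m := [set w | disc (natmx R (A m w)) <= r (n m) + 1].
  have G1 m : (P m (G m) <= 1)%E.
    apply: probability_le1.
    exact: (measurable_mx_event (A_poisson m) (fun M => disc (natmx R M) <= r (n m) + 1)).
  have Gfin m : P m (G m) \is a fin_num.
    by rewrite ge0_fin_numE // (le_lt_trans (G1 m)) // ltry.
  apply/fine_cvgP; split; first by near=> m; exact: Gfin.
  apply/cvgrPdist_le => e e0.
  have := main (Num.min e 1); rewrite lt_min e0 ltr01 ge_min lexx orbT => /(_ isT isT).
  apply: filterS => m; rewrite -/(G m) -(fineK (Gfin m)) lee_fin /= => H.
  have := G1 m; rewrite -(fineK (Gfin m)) lee_fin => H1.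
  rewrite ger0_norm ?subr_ge0 //.
  have : Num.min e 1 <= e by rewrite ge_min lexx.
  by move: H; lra.
move=> e0 e1; have [eta [n0 [eta0 key]]] := bad_family_small c0 e0 e1.
near=> m.
have m_gt0 : (0 < m)%N by near: m; exact: nbhs_infty_gt.
have mn : m%:R <= eta * (n m)%:R by near: m; exact: n_dom.
(* The comparison with constant [1] gives [m <= n]: this is how [n] is positive and eventually
   exceeds [n0]. *)
have mn1 : m%:R <= 1 * (n m)%:R :> R by near: m; exact: (n_dom 1 ltr01).
have n0m : n0 <= m%:R.
  near: m; exists (Num.truncn n0).+1 => // k /= kn.
  by apply: (le_trans (ltW (truncnS_gt n0))); rewrite ler_nat.
have EZm : ((c * (n m)%:R)%:E <= lne 'E_(P m)[fun w =>
     (balanced_count (r (n m)) (natmx R (A m w)))%:R])%E.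
  by near: m; apply: filterS EZ => m /andP[].
rewrite mul1r ler_nat in mn1.
have np : (0 < n m)%N by exact: leq_trans mn1.
have nh : n m = (n m)./2.*2 by rewrite even_halfK // n_even.
have h0 : (0 < (n m)./2)%N by rewrite half_gt0; move: np nh; case: (n m) => [//|[//|]].
have b_ge := expR_le_of_lne EZm
  (expectation_balanced_count_le np (lambda_gt0 m) (A_poisson m) (r_ge0 m)).
set k := Num.truncn (r (n m)) in b_ge.
(* The first moment concerns the window [k], the second moment the enlarged window [k + 1]; the
   bound on [p] only grows in passing from [k + 1] to [k + 2] endpoints. *)
have b_ge' : expR (c * (n m)%:R) <= (balanced_num (n m))%:R *
    Num.min 1 (k.+2%:R / Num.sqrt ((n m)%:R * lambda (n m))) ^+ m.
  apply: (le_trans b_ge); rewrite ler_wpM2l // lerXn2r ?nnegrE ?le_min ?ler01 ?divr_ge0 ?sqrtr_ge0 //.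
  rewrite ge_min lexx /= ge_min; apply/orP; right.
  by rewrite ler_wpM2r ?invr_ge0 ?sqrtr_ge0 // ler_nat.
have [K0 bad] := key m (n m) (n m)./2 k.+1 (lambda (n m)) nh m_gt0 h0 isT
  (lambda_gt0 m) (le_trans n0m (etrans (ler_nat R _ _) mn1)) mn b_ge'.
pose S (M : 'M[nat]_(m, n m)) := ~~ (disc (natmx R M) <= r (n m) + 1).
have PS : (P m [set w | S (A m w)] <= eps%:E)%E.
  apply: (prob_mx_event_le (A_poisson m) (K0 := K0)) => K KK0.
  apply: le_trans (bad K KK0); apply: ler_sum => f _; rewrite ler_wpM2l ?fam_pmf_ge0 //.
  rewrite ler_nat /S; have := @disc_le_fam R m (n m) K.+1 (r (n m)) f (r_ge0 m).
  by case: (fam_bad _ f) => [_|-> //]; case: (~~ _).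
have mS : measurable [set w | S (A m w)] by exact: measurable_mx_event (A_poisson m) S.
rewrite (_ : [set w | _] = ~` [set w | S (A m w)]); last first.
  by apply/seteqP; split => w /=; rewrite /S; [move=> -> | move/negP; rewrite negbK].
by rewrite probability_setC // EFinB leeB.
Unshelve. all: by end_near. Qed.
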